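(* Let $n\ge1$ be an integer. For any non-empty Borel set $A\subset\mathbb{R}^n$, $$\begin{aligned}\dim_P A&=n-\inf\{\dim_H B: B\subset\mathbb{R}^n\text{ compact},\ \mathrm{int}(A+B)\ne\emptyset\}\\&=n-\inf\{\dim_H B: B\subset\mathbb{R}^n\text{ Borel},\ A+B=\mathbb{R}^n\}.\end{aligned}$$
   Context: $\dim_H$ and $\dim_P$ denote Hausdorff and packing dimension respectively. $A+B=\{a+b:a\in A,\ b\in B\}$ is the Minkowski sum, and $\mathrm{int}$ denotes interior. *)

(* Defs.v *)
From HB Require Import structures.
From mathcomp Require Import all_boot all_order all_algebra.
From mathcomp Require Import all_classical all_reals all_analysis.
Import Order.TTheory GRing.Theory Num.Theory.
Import numFieldNormedType.Exports.

Set Implicit Arguments.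
Unset Strict Implicit.
Unset Printing Implicit Defensive.

Local Open Scope classical_set_scope.
Local Open Scope ring_scope.

(* The library norm on 'rV[R]_n is the sup norm. It induces the usual topology,
   so it is used for openness and compactness; diameters and balls below are
   taken in the Euclidean metric. *)
Definition euclidean_dist (R : realType) (n : nat) (x y : 'rV[R]_n) : R :=
  Num.sqrt (\sum_(i < n) (x ord0 i - y ord0 i) ^+ 2).

Definition closed_eball (R : realType) (n : nat) (x : 'rV[R]_n) (r : R) :
    set 'rV[R]_n :=
  [set y | euclidean_dist x y <= r].

Definition diameter (R : realType) (n : nat) (U : set 'rV[R]_n) : \bar R :=
  maxe 0%E (ereal_sup [set (euclidean_dist x y)%:E | x in U & y in U]).

(* Since 0 `^ 0 = 1, the empty set is treated apart, so that |set0|^s = 0 also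
   for s = 0. *)
Definition diam_pow (R : realType) (n : nat) (s : R) (U : set 'rV[R]_n) :
    \bar R :=
  if `[< U = set0 >] then 0%E else (diameter U `^ s)%E.

Definition hausdorff_premeasure (R : realType) (n : nat) (s d : R)
    (E : set 'rV[R]_n) : \bar R :=
  ereal_inf [set (\sum_(0 <= i <oo) diam_pow s (U i))%E |
    U in [set U : nat -> set 'rV[R]_n |
      (forall i, (diameter (U i) <= d%:E)%E) /\ E `<=` \bigcup_i U i]].

Definition hausdorff_measure (R : realType) (n : nat) (s : R)
    (E : set 'rV[R]_n) : \bar R :=
  ereal_sup [set hausdorff_premeasure s d E | d in [set d : R | 0 < d]].

Definition hausdorff_dim (R : realType) (n : nat) (E : set 'rV[R]_n) : \bar R :=
  ereal_inf [set s%:E | s in [set s : R | 0 <= s /\ hausdorff_measure s E = 0%E]].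

(* Packings of E by disjoint closed balls of radius at most d centred in E; the
   index set D makes them finite or countably infinite. The ball of centre
   [x i] and radius [r i] has diameter [2 * r i] as soon as n is positive. *)
Definition is_packing (R : realType) (n : nat) (d : R) (E : set 'rV[R]_n)
    (D : set nat) (x : nat -> 'rV[R]_n) (r : nat -> R) : Prop :=
  (forall i, D i -> E (x i) /\ 0 < r i <= d) /\
  trivIset D (fun i => closed_eball (x i) (r i)).

Definition packing_content (R : realType) (n : nat) (s d : R)
    (E : set 'rV[R]_n) : \bar R :=
  ereal_sup [set v : \bar R | exists (D : set nat) (x : nat -> 'rV[R]_n)
      (r : nat -> R),
    is_packing d E D x r /\ v = \esum_(i in D) ((2 * r i) `^ s)%:E].

Definition packing_premeasure (R : realType) (n : nat) (s : R)
    (E : set 'rV[R]_n) : \bar R :=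
  ereal_inf [set packing_content s d E | d in [set d : R | 0 < d]].

(* The packing premeasure is not countably subadditive, hence the second
   infimum, over countable covers. *)
Definition packing_measure (R : realType) (n : nat) (s : R)
    (E : set 'rV[R]_n) : \bar R :=
  ereal_inf [set (\sum_(0 <= i <oo) packing_premeasure s (F i))%E |
    F in [set F : nat -> set 'rV[R]_n | E `<=` \bigcup_i F i]].

Definition packing_dim (R : realType) (n : nat) (E : set 'rV[R]_n) : \bar R :=
  ereal_inf [set s%:E | s in [set s : R | 0 <= s /\ packing_measure s E = 0%E]].

Definition borel_set (R : realType) (n : nat) (E : set 'rV[R]_n) : Prop :=
  <<s @open 'rV[R]_n >> E.

Definition minkowski_sum (R : realType) (n : nat) (A B : set 'rV[R]_n) :
    set 'rV[R]_n :=
  [set a + b | a in A & b in B].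

(* Main.v *)
Require Import Defs.
From HB Require Import structures.
From mathcomp Require Import all_boot all_order all_algebra.
From mathcomp Require Import all_classical all_reals all_analysis.
From mathcomp Require Import ring lra.
Import Order.TTheory GRing.Theory Num.Theory.
Import numFieldNormedType.Exports.

Local Open Scope classical_set_scope.
Local Open Scope ring_scope.

Set Implicit Arguments.
Unset Strict Implicit.
Unset Printing Implicit Defensive.

(** Call a set [s]-box-bounded if its [r]-separated finite subsets have at most
    [C * r `^ (- s)] points for all small [r]. A set of zero [s]-dimensional
    packing measure is a countable union of [s]-box-bounded sets
    ([packing_measure_sigma_box_bounded]), and such a union has zero
    [t]-dimensional packing measure for [t > s]
    ([sigma_box_bounded_packing_measure]). So [dim_P A] is the infimum of the
    [s >= 0] for which [A] belongs to the sigma-ideal generated by the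
    [s]-box-bounded sets.

    If [A] is in the ideal for [s], if [B] has zero [t]-dimensional Hausdorff
    measure and [s + t <= n], then [A + B] has volume zero: a piece of diameter
    [r] in a cover of [B] and a piece of [A] have a sum covered by a multiple of
    [r `^ (- s)] cubes of radius comparable to [r], of total volume
    [r `^ (n - s) <= r `^ t] ([no_cube_in_sum]). Hence [dim_H B >= n - dim_P A]
    as soon as [A + B] contains a cube.

    Conversely, let [s < dim_P A] and [t > n - s]. A Borel set is Suslin
    ([borel_suslin]), so [A] is explored by a countably branching tree of sets
    whose branches converge to points of [A]. The points of a node near which
    it is small form a member of the ideal ([sigma_box_bounded_nonthick]); what
    remains contains, at arbitrarily small scales [h], more than [h `^ (- s)] separated
    points. A greedy choice then finds about [h `^ (s - n)] translates of these
    points, up to a logarithm, that fill a given cube at scale [h]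
    ([sumset_cover]). Iterating at rapidly decreasing scales, which may differ
    from node to node, yields a finitely branching tree whose translations
    converge to a compact set [B] with [A + B] containing a cube and with covers
    of arbitrarily small [t]-dimensional sum ([thin_summand]). The union of the
    translates of [B] by a lattice gives a Borel set with the same bound on its
    dimension, whose sum with [A] is the whole space. *)

(** * Metrics, cubes and the Borel sets of the space *)

Section Metrics.
Context {R : realType} {n : nat}.
Implicit Types (x y z : 'rV[R]_n) (r : R).

Lemma coord_le_norm x i : `|x ord0 i| <= `|x|.
Proof.
have -> : `|x| = mx_norm x by [].
rewrite mx_normrE.
exact: (le_bigmax _ (fun ij : 'I_1 * 'I_n => `|x ij.1 ij.2|) (ord0, i)).
Qed.

Lemma norm_le_coord x r : 0 <= r -> (forall i, `|x ord0 i| <= r) -> `|x| <= r.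
Proof.
move=> r0 xr.
have -> : `|x| = mx_norm x by [].
rewrite mx_normrE; apply: bigmax_le => // -[i j] _ /=.
by rewrite (ord1 i).
Qed.

Lemma norm_le_euclidean_dist x y : `|x - y| <= euclidean_dist x y.
Proof.
apply: norm_le_coord => [|i]; first exact: sqrtr_ge0.
rewrite !mxE -sqrtr_sqr; apply: ler_wsqrtr.
rewrite (bigD1 i) //= lerDl; apply: sumr_ge0 => j _; exact: sqr_ge0.
Qed.

Lemma euclidean_dist_le_norm x y : euclidean_dist x y <= n%:R * `|x - y|.
Proof.
have n0 : (0 : R) <= n%:R by [].
rewrite -[leRHS]ger0_norm ?mulr_ge0 // -sqrtr_sqr; apply: ler_wsqrtr.
apply: (@le_trans _ _ (\sum_(i < n) `|x - y| ^+ 2)).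
  apply: ler_sum => i _; rewrite -real_normK ?num_real // ler_pXn2r ?nnegrE //.
  by have := coord_le_norm (x - y) i; rewrite !mxE.
rewrite sumr_const card_ord -[leLHS]mulr_natl exprMn ler_wpM2r ?sqr_ge0 //.
by rewrite -natrX ler_nat; case: (n) => // k; rewrite expnS expn1 leq_pmulr.
Qed.

Definition cube x (r : R) : set 'rV[R]_n := [set y | `|y - x| <= r].

Lemma closed_cube (x : 'rV[R]_n) r : closed (cube x r).
Proof.
move=> y cly; rewrite /cube /=; apply/ler_addgt0Pr => e e0.
have /cly[z [/= zx]] : nbhs y (ball y e) by exact: nbhsx_ballx.
rewrite -ball_normE /= => /ltW yz.
have := ler_distD z y x; move: zx; rewrite /cube /=; lra.
Qed.

Lemma compact_cube (x : 'rV[R]_n) r : compact (cube x r).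
Proof.
apply: bounded_closed_compact; last exact: closed_cube.
exists (r + `|x|); split; first exact: num_real.
move=> M rM y; rewrite /cube /= => yx.
have := ler_normD (y - x) x; rewrite subrK; lra.
Qed.

(** Each coordinate of the limit is the supremum of the left ends of a nested
    sequence of intervals. *)
Lemma shrinking_limit (c : R) (x : nat -> 'rV[R]_n) (r : nat -> R) :
  0 <= c -> (forall k, 0 <= r k) -> (forall k, r k.+1 <= r k / 2) ->
  (forall k, `|x k.+1 - x k| <= c * r k) ->
  exists l, forall k, `|l - x k| <= 2 * c * r k.
Proof.
move=> c0 r0 rS xS.
have nest k m : `|x (k + m)%N - x k| <= 2 * c * (r k - r (k + m)%N).
  elim: m => [|m IH]; first by rewrite addn0 !subrr normr0 mulr0.
  rewrite addnS; have := ler_distD (x (k + m)%N) (x (k + m).+1) (x k).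
  have := xS (k + m)%N; have := ler_wpM2l c0 (rS (k + m)%N).
  move: IH; rewrite !mulrBr; lra.
pose lo i k := x k ord0 i - 2 * c * r k; pose hi i k := x k ord0 i + 2 * c * r k.
have coord i k m : lo i k <= lo i (k + m)%N /\ hi i (k + m)%N <= hi i k.
  have := le_trans (coord_le_norm _ i) (nest k m); rewrite !mxE ler_norml mulrBr.
  by rewrite /lo /hi => /andP[? ?]; split; lra.
have lohi i k : lo i k <= hi i k.
  have := mulr_ge0 c0 (r0 k); rewrite /lo /hi; lra.
have le_lo_hi i k m : lo i k <= hi i m.
  have [km|/ltnW mk] := leqP k m.
    rewrite -(subnKC km); apply: (le_trans (coord i k _).1); exact: lohi.
  rewrite -(subnKC mk); apply: (le_trans (lohi i _)); exact: (coord i m _).2.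
exists (\row_i sup (range (lo i))) => k.
apply: norm_le_coord => [|i]; first by rewrite !mulr_ge0.
have ub m : ubound (range (lo i)) (hi i m) by move=> _ [j _ <-]; exact: le_lo_hi.
have ne : range (lo i) !=set0 by exists (lo i 0%N), 0%N.
rewrite !mxE ler_norml; apply/andP; split.
  have : lo i k <= sup (range (lo i)).
    by apply: ub_le_sup; [exists (hi i 0%N); exact: ub|exists k].
  rewrite /lo; lra.
have : sup (range (lo i)) <= hi i k by apply: ge_sup.
rewrite /hi; lra.
Qed.

(** Increasing open sets: a finite subcover is contained in its last member. *)
Lemma compact_increasing (K : set 'rV[R]_n) (O : nat -> set 'rV[R]_n) :
  compact K -> (forall k, open (O k)) -> (forall k, O k `<=` O k.+1) ->
  K `<=` \bigcup_k O k -> exists k, K `<=` O k.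
Proof.
rewrite compact_cover => /(_ nat setT O) cK oO mono KO.
have [D _ KD] := cK (fun k _ => oO k) KO.
have monoD k m : (k <= m)%N -> O k `<=` O m.
  move=> /subnKC <-; elim: (m - k)%N => [|j IH]; first by rewrite addn0.
  by rewrite addnS; apply: subset_trans IH _; exact: mono.
exists (\max_(k <- finmap.enum_fset D) k) => y /KD[k kD yk].
by apply: monoD yk; exact: (@leq_bigmax_seq _ _ xpredT id).
Qed.

Lemma borel_closed (B : set 'rV[R]_n) : closed B -> borel_set B.
Proof.
move=> cB; rewrite -[B]setCK; apply: sigma_algebraC.
by apply: sub_sigma_algebra; exact: closed_openC.
Qed.

Lemma closed_translate (B : set 'rV[R]_n) (v : 'rV[R]_n) : closed B -> closed [set b + v | b in B].
Proof.
move=> cB; have -> : [set b + v | b in B] = (fun x => x - v) @^-1` B.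
  apply/seteqP; split=> [_ [b Bb <-]|x Bx]; first by rewrite /preimage /= addrK.
  by exists (x - v); rewrite ?subrK.
apply: closed_comp => // x _.
by apply: continuousB; [exact: cvg_id|exact: cst_continuous].
Qed.

End Metrics.

(** * Rounding to a grid *)

Section Grid.
Context {R : realType} {n : nat}.
Implicit Types (x y : 'rV[R]_n) (h a : R).

(** Cell indices live in a finite type so that points can be counted; an index
    is meaningful only for coordinates in [[0, W.+1 * h)], and [inord] maps the
    others to 0. *)
Definition grid_cell h (W : nat) x : {ffun 'I_n -> 'I_W.+1} :=
  [ffun i => inord (Num.truncn (x ord0 i / h))].

Definition grid_point h (W : nat) (g : {ffun 'I_n -> 'I_W.+1}) : 'rV[R]_n :=
  \row_i ((g i)%:R * h).

Lemma grid_cellP h a x i : 0 < h -> (forall i, 0 <= x ord0 i <= a) ->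
  let g := grid_cell h (Num.truncn (a / h)) x in
  0 <= (x - grid_point h g) ord0 i <= h.
Proof.
move=> h0 xa; have /andP[x0 xia] := xa i.
rewrite /= !mxE ffunE inordK; last first.
  by rewrite ltnS le_truncn // ler_pM2r ?invr_gt0.
have xh0 : 0 <= x ord0 i / h by rewrite divr_ge0 // ltW.
have /andP[] := truncn_itv xh0.
rewrite ler_pdivlMr // ltr_pdivrMr // => le1 lt1.
rewrite subr_ge0 le1 /= lerBlDr addrC.
by rewrite (le_trans (ltW lt1)) // -natr1 mulrDl mul1r.
Qed.

Lemma grid_cell_near h a x : 0 < h -> (forall i, 0 <= x ord0 i <= a) ->
  `|x - grid_point h (grid_cell h (Num.truncn (a / h)) x)| <= h.
Proof.
move=> h0 xa; apply: norm_le_coord => [|i]; first exact: ltW.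
by have /andP[d0 dh] := grid_cellP i h0 xa; rewrite ger0_norm.
Qed.

Lemma grid_cell_eq h a x y : 0 < h ->
  (forall i, 0 <= x ord0 i <= a) -> (forall i, 0 <= y ord0 i <= a) ->
  grid_cell h (Num.truncn (a / h)) x = grid_cell h (Num.truncn (a / h)) y ->
  `|x - y| <= h.
Proof.
move=> h0 xa ya xy; apply: norm_le_coord => [|i]; first exact: ltW.
have := grid_cellP i h0 xa; have := grid_cellP i h0 ya; rewrite /= xy.
rewrite !mxE; set c := _%:R * h; move=> /andP[? ?] /andP[? ?].
by rewrite ler_norml; apply/andP; split; lra.
Qed.

Lemma card_grid h a : 0 < h -> 0 <= a ->
  #|{ffun 'I_n -> 'I_(Num.truncn (a / h)).+1}|%:R <= (a / h + 1) ^+ n.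
Proof.
move=> h0 a0; rewrite card_ffun !card_ord natrX.
have ah0 : 0 <= a / h by rewrite divr_ge0 // ltW.
rewrite lerXn2r ?nnegrE ?addr_ge0 //.
by rewrite -natr1 lerD2r truncn_le.
Qed.

Lemma grid_point_itv (h a : R) (g : {ffun 'I_n -> 'I_(Num.truncn (a / h)).+1})
    i :
  0 < h -> 0 <= a -> 0 <= grid_point h g ord0 i <= a.
Proof.
move=> h0 a0; have ah0 : 0 <= a / h by rewrite divr_ge0 // ltW.
rewrite mxE mulr_ge0 ?(ltW h0) //= -ler_pdivlMr //.
apply: (@le_trans _ _ (Num.truncn (a / h))%:R); last by rewrite truncn_le.
by rewrite ler_nat -ltnS.
Qed.

Definition lattice_point (h : R) (g : 'rV[int]_n) : 'rV[R]_n :=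
  \row_i ((g ord0 i)%:~R * h).

Lemma lattice_near h x : 0 < h -> exists g, cube (lattice_point h g) h x.
Proof.
move=> h0; exists (\row_i Num.floor (x ord0 i / h)).
apply: norm_le_coord => [|i]; first exact: ltW.
rewrite !mxE; have := floor_itv (x ord0 i / h).
rewrite ler_pdivlMr // ltr_pdivrMr // intrD mulrDl mul1r => /andP[? ?].
by rewrite ler_norml; apply/andP; split; lra.
Qed.

End Grid.

(** * Powers and geometric sums *)

Section Powers.
Context {R : realType}.
Implicit Types e h x y : R.

Lemma ler_powR_base (e x y : R) : 0 <= e -> 0 <= x -> x <= y ->
  x `^ e <= y `^ e.
Proof.
by move=> e0 x0 xy; apply: ge0_ler_powR; rewrite ?nnegrE // (le_trans x0).
Qed.

Lemma powR_small (e eta : R) : 0 < e -> 0 < eta ->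
  exists2 d, 0 < d & forall r, 0 <= r <= d -> r `^ e <= eta.
Proof.
move=> e0 eta0; exists (eta `^ e^-1); first exact: powR_gt0.
move=> r /andP[r0 rd].
have -> : eta = (eta `^ e^-1) `^ e.
  by rewrite -powRrM mulVf ?gt_eqF // powRr1 // ltW.
by apply: ler_powR_base => //; exact: ltW.
Qed.

Lemma geometric_sum_le (q : R) (N : nat) : 0 <= q < 1 ->
  \sum_(i < N) q ^+ i <= (1 - q)^-1.
Proof.
move=> /andP[q0 q1]; have q10 : 0 < 1 - q by rewrite subr_gt0.
rewrite -[leRHS]mul1r ler_pdivlMr // mulrC.
by rewrite -[_ * _]opprK -mulNr opprB -subrX1 opprB lerBlDr lerDl exprn_ge0.
Qed.

Lemma ln_div_le_powR (a h e : R) : 0 < h -> 0 < a -> 0 < e ->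
  ln (a / h) <= a `^ e / e * h `^ (- e).
Proof.
move=> h0 a0 e0; have ah0 : 0 < a / h by rewrite divr_gt0.
have : e * ln (a / h) <= (a / h) `^ e.
  rewrite -ln_powR; have p0 : 0 < (a / h) `^ e by exact: powR_gt0.
  have := @le_ln1Dx R ((a / h) `^ e - 1); rewrite [1 + _]addrC subrK => le1.
  by apply: le_trans (le1 _) _; lra.
rewrite powRM ?invr_ge0 ?(ltW a0) ?(ltW h0) // -[h^-1]powR_inv1 ?(ltW h0) //.
by rewrite -powRrM mulN1r mulrAC ler_pdivlMr // mulrC.
Qed.

Lemma half_pow_small (e : R) : 0 < e -> exists k, 2^-1 ^+ k <= e.
Proof.
move=> e0; exists (Num.truncn e^-1); rewrite exprVn invf_ple ?posrE ?exprn_gt0 //.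
apply: (le_trans (ltW (truncnS_gt _))).
by rewrite -natrX ler_nat ltn_expl.
Qed.

Lemma half_powers_sum_le (K : nat) :
  \sum_(i < K) ((2 ^ i.+1)%:R^-1 : R) <= 1.
Proof.
suff -> : \sum_(i < K) ((2 ^ i.+1)%:R^-1 : R) = 1 - (2 ^ K)%:R^-1.
  by rewrite gerBl invr_ge0.
elim: K => [|K IH]; first by rewrite big_ord0 expn0 invr1 subrr.
rewrite big_ord_recr /= IH expnS natrM; field.
by rewrite pnatr_eq0 expn_eq0.
Qed.

End Powers.

(** * Box-bounded sets *)

Section BoxBounded.
Context {R : realType} {n : nat}.
Implicit Types (X Y A : set 'rV[R]_n) (r s d : R) (l : seq 'rV[R]_n).

Definition spaced r l := pairwise (fun x y => r < `|x - y|) l.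

(** The upper box dimension of [X] is at most [s] exactly when [X] has this
    property for every larger exponent. *)
Definition box_bounded s X := exists C d : R, 0 < d /\
  forall r l, 0 < r <= d -> spaced r l -> (forall x, x \in l -> X x) ->
    (size l)%:R <= C * r `^ (- s).

(** The sigma-ideal generated by the box-bounded sets; packing dimension is the
    critical exponent of membership in it. *)
Definition sigma_box_bounded s X := exists F : nat -> set 'rV[R]_n,
  X `<=` \bigcup_i F i /\ forall i, box_bounded s (F i).

Lemma spaced_uniq r l : 0 <= r -> spaced r l -> uniq l.
Proof.
move=> r0; apply: pairwise_uniq => x /=.
by rewrite subrr normr0; apply/negbTE; rewrite -leNgt.
Qed.

Lemma spacedP r l x y : 0 <= r -> spaced r l -> x \in l -> y \in l ->
  `|x - y| <= r -> x = y.
Proof.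
move=> r0; elim: l => // z l IH /= /andP[/allP zl sl].
rewrite !inE => /predU1P[->|xl] /predU1P[->|yl] // dxy.
- by have := zl _ yl; rewrite ltNge dxy.
- by have := zl _ xl; rewrite distrC ltNge dxy.
- exact: IH.
Qed.

Lemma box_bounded_set0 s : box_bounded s set0.
Proof.
exists 0, 1; split => // r [|x l] rd sl lX; first by rewrite mul0r.
by case: (lX x); rewrite mem_head.
Qed.

Lemma sigma_box_bounded_sub s X Y : X `<=` Y ->
  sigma_box_bounded s Y -> sigma_box_bounded s X.
Proof. by move=> XY [F [YF bF]]; exists F; split => // x /XY/YF. Qed.

Lemma box_bounded_sigma s X : box_bounded s X -> sigma_box_bounded s X.
Proof. by move=> bX; exists (fun=> X); split => // x Xx; exists 0%N. Qed.

Lemma sigma_box_bounded_bigcup s (I : countType) (F : I -> set 'rV[R]_n) :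
  (forall i, sigma_box_bounded s (F i)) ->
  sigma_box_bounded s (\bigcup_i F i).
Proof.
move=> /choice[G GF].
exists (fun k => if unpickle k is Some (i, j) then G i j else set0); split.
  move=> x [i _ /(GF i).1[j _ Gx]]; exists (pickle (i, j)) => //.
  by rewrite pickleK.
move=> k; case: unpickle => [[i j]|]; first exact: (GF i).2.
exact: box_bounded_set0.
Qed.

Lemma sigma_box_boundedU s X Y : sigma_box_bounded s X ->
  sigma_box_bounded s Y -> sigma_box_bounded s (X `|` Y).
Proof.
move=> bX bY; have : sigma_box_bounded s (\bigcup_b if b then X else Y).
  by apply: sigma_box_bounded_bigcup => -[].
by apply: sigma_box_bounded_sub => x [Xx|Yx]; [exists true|exists false].
Qed.

(** One point already violates a bound that tends to 0 with the scale. *)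
Lemma sigma_box_bounded_neg s X : s < 0 -> sigma_box_bounded s X -> X = set0.
Proof.
move=> s0 [F [XF bF]]; apply/seteqP; split => // x /XF[i _ Fx].
have [C [d [d0 HC]]] := bF i.
have [||e e0 He] := @powR_small R (- s) (2 * (`|C| + 1))^-1.
- by rewrite oppr_gt0.
- by rewrite invr_gt0 mulr_gt0 // ltr_wpDl.
have := HC (Num.min d e) [:: x]; rewrite lt_min d0 e0 ge_min lexx /=.
have Fx1 : forall y, y \in [:: x] -> F i y by move=> y; rewrite inE => /eqP->.
move=> /(_ isT isT Fx1).
set p := _ `^ _ => h.
have p0 : 0 <= p by exact: powR_ge0.
have : p <= (2 * (`|C| + 1))^-1.
  by apply: He; rewrite le_min (ltW d0) (ltW e0) ge_min lexx orbT.
have C0 : 0 <= `|C| by [].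
have C2 : 0 < 2 * (`|C| + 1) by rewrite mulr_gt0 // ltr_wpDl.
rewrite -[leRHS]mul1r ler_pdivlMr // => h2.
have : C * p <= `|C| * p by rewrite ler_wpM2r // ler_norm.
nra.
Qed.

Lemma box_bounded_ball (k : R) : 0 <= k ->
  box_bounded n%:R [set x : 'rV[R]_n | `|x| <= k].
Proof.
move=> k0; exists ((2 * k + 1) ^+ n), 1; split => // r l /andP[r0 r1] sl lX.
have shift x : x \in l -> forall i, 0 <= (x + const_mx k) ord0 i <= 2 * k.
  move=> /lX /= xk i; rewrite !mxE; have := le_trans (coord_le_norm x i) xk.
  by rewrite ler_norml => /andP[? ?]; apply/andP; split; lra.
pose f (x : 'rV[R]_n) := grid_cell r (Num.truncn (2 * k / r)) (x + const_mx k).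
have finj : {in l &, injective f}.
  move=> x y xl yl fxy; apply: (spacedP (ltW r0) sl) => //.
  have := grid_cell_eq r0 (shift _ xl) (shift _ yl) fxy.
  by rewrite opprD addrACA subrr addr0.
have ul : uniq (map f l) by rewrite map_inj_in_uniq // (spaced_uniq (ltW r0)).
have : (size l <= #|{ffun 'I_n -> 'I_(Num.truncn (2 * k / r)).+1}|)%N.
  by rewrite -(size_map f) -(card_uniqP ul) max_card.
rewrite -(ler_nat R) => /le_trans; apply.
have k20 : 0 <= 2 * k by rewrite mulr_ge0.
apply: (le_trans (card_grid r0 k20)).
rewrite powRN powR_mulrn; last exact: ltW.
rewrite -exprVn -exprMn lerXn2r ?nnegrE //.
- by rewrite addr_ge0 // divr_ge0 // ltW.
- by rewrite mulr_ge0 ?addr_ge0 // invr_ge0 ltW.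
- by rewrite [leRHS]mulrDl mul1r lerD2l -[leLHS]invr1 lef_pV2 ?posrE.
Qed.

Lemma sigma_box_boundedT : sigma_box_bounded n%:R [set: 'rV[R]_n].
Proof.
exists (fun k => [set x : 'rV[R]_n | `|x| <= k%:R]); split; last first.
  by move=> k; exact: box_bounded_ball.
move=> x _; exists (Num.truncn `|x|).+1 => //=.
exact/ltW/truncnS_gt.
Qed.

End BoxBounded.

(** * Packing measures *)

Section Packing.
Context {R : realType} {n : nat}.
Implicit Types (X Y A : set 'rV[R]_n) (r s t d : R) (l : seq 'rV[R]_n).

Lemma packing_content_ge0 s d X : (0 <= packing_content s d X)%E.
Proof.
apply: ereal_sup_ubound; exists set0, (fun=> 0), (fun=> 0); split.
  by split => //; exact: trivIset_set0.
by rewrite esum_set0.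
Qed.

Lemma packing_premeasure_ge0 s X : (0 <= packing_premeasure s X)%E.
Proof. by apply: le_ereal_inf_tmp => _ [d _ <-]; exact: packing_content_ge0. Qed.

Lemma packing_measure_ge0 s X : (0 <= packing_measure s X)%E.
Proof.
apply: le_ereal_inf_tmp => _ [F _ <-]; apply: nneseries_ge0 => i _ _.
exact: packing_premeasure_ge0.
Qed.

(** Balls of radius [r / 2] around [r]-separated points form a packing, so a
    finite packing content bounds the number of such points. *)
Lemma packing_premeasure_box_bounded s X :
  (packing_premeasure s X < 1)%E -> box_bounded s X.
Proof.
move=> /ereal_inf_lt[_ [d /= d0 <-] content1].
exists 1, d; split => // r l /andP[r0 rd] sl lX.
have : ((\esum_(i in `I_(size l)) ((2 * (r / 2)) `^ s)%:E) < 1)%E.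
  apply: le_lt_trans content1; apply: ereal_sup_ubound.
  exists `I_(size l), (nth 0 l), (fun=> r / 2); split => //; split.
    move=> i /= il; split; first by apply: lX; exact: mem_nth.
    by rewrite divr_gt0 //=; lra.
  apply/trivIsetP => i j /= il jl ij; rewrite -subset0 => y [/= yi yj].
  have : `|nth 0 l i - nth 0 l j| <= r.
    have := le_trans (norm_le_euclidean_dist _ _) yi.
    have := le_trans (norm_le_euclidean_dist _ _) yj.
    have := ler_distD y (nth 0 l i) (nth 0 l j).
    rewrite [`|y - _|]distrC; lra.
  move=> /(spacedP (ltW r0) sl (mem_nth _ il) (mem_nth _ jl)) /eqP.
  by rewrite nth_uniq ?(spaced_uniq (ltW r0) sl) // (negbTE ij).
rewrite esum_fset //; last by move=> i _; rewrite lee_fin powR_ge0.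
rewrite -fsbig_ord sumEFin lte_fin sumr_const card_ord.
rewrite (_ : 2 * (r / 2) = r); last by rewrite mulrC divfK.
move=> h; rewrite mul1r powRN -[leRHS]mul1r ler_pdivlMr ?powR_gt0 //.
by rewrite mulr_natl ltW.
Qed.

Lemma packing_measure_sigma_box_bounded s A :
  packing_measure s A = 0%E -> sigma_box_bounded s A.
Proof.
move=> PA0; have : (packing_measure s A < 1)%E by rewrite PA0 lte_fin.
move=> /ereal_inf_lt[_ [F /= AF <-] sum1]; exists F; split => // i.
apply: packing_premeasure_box_bounded; apply: le_lt_trans sum1.
apply: (@le_trans _ _ (\sum_(0 <= j < i.+1) packing_premeasure s (F j))%E).
  rewrite big_nat_recr //= leeDr //; apply: sume_ge0 => j _.
  exact: packing_premeasure_ge0.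
by apply: nneseries_lim_ge => j _ _; exact: packing_premeasure_ge0.
Qed.

Lemma dyadic_level (delta r : R) : 0 < r <= delta ->
  exists m, delta * 2^-1 ^+ m.+1 < r <= delta * 2^-1 ^+ m.
Proof.
move=> /andP[r0 rd].
have ex : exists m, delta * 2^-1 ^+ m.+1 < r.
  exists (Num.truncn (delta / r)).
  rewrite exprVn ltr_pdivrMr ?exprn_gt0 // mulrC -ltr_pdivrMr //.
  apply: (lt_le_trans (truncnS_gt _)).
  by rewrite -natrX ler_nat ltnW // ltn_expl.
case: (ex_minnP ex) => m rm minm; exists m; rewrite rm /=.
case: m minm {rm} => [_|m minm]; first by rewrite expr0 mulr1.
by rewrite leNgt; apply/negP => /minm; rewrite ltnn.
Qed.

(** Disjoint balls of comparable radii have separated centres, so each dyadic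
    range of radii contributes a term of a convergent geometric series. *)
Lemma packing_sum_le s t (C d delta : R) X D x (rad : nat -> R)
    (J : seq nat) :
  (forall r l, 0 < r <= d -> spaced r l -> (forall x, x \in l -> X x) ->
    (size l)%:R <= C * r `^ (- s)) ->
  s < t -> 0 <= t -> 0 < delta <= d -> is_packing delta X D x rad ->
  uniq J -> (forall i, i \in J -> D i) ->
  \sum_(i <- J) (2 * rad i) `^ t <=
    C * (2 * n.+1%:R) `^ s * 2 `^ t * (1 - 2^-1 `^ (t - s))^-1 *
    delta `^ (t - s).
Proof.
move=> HC st t0 /andP[delta0 deltad] [Dr triv] uJ JD.
have /choice[lev levP] : forall i, exists m, D i ->
    delta * 2^-1 ^+ m.+1 < rad i <= delta * 2^-1 ^+ m.
  move=> i; have [Di|] := pselect (D i); last by exists 0%N.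
  by have [m mP] := dyadic_level (Dr i Di).2; exists m.
pose M := \max_(i <- J) lev i.
have levM i : i \in J -> (lev i <= M)%N by move=> iJ; exact: leq_bigmax_seq.
rewrite (partition_big (fun i => inord (lev i) : 'I_M.+1) predT) //=.
pose q (m : nat) := delta * 2^-1 ^+ m.
have q0 m : 0 < q m by rewrite mulr_gt0 ?exprn_gt0 ?invr_gt0.
pose K := C * (2 * n.+1%:R) `^ s * 2 `^ t.
have n2 : 0 < 2 * n.+1%:R :> R by rewrite mulr_gt0.
apply: (@le_trans _ _ (\sum_(m < M.+1) K * delta `^ (t - s) *
    (2^-1 `^ (t - s)) ^+ m)); last first.
  rewrite -mulr_sumr -/K [leRHS]mulrAC; apply: ler_wpM2l.
    have := HC d [::]; rewrite (lt_le_trans delta0) // lexx.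
    have nil x0 : x0 \in [::] -> X x0 by [].
    move=> /(_ isT isT nil); rewrite pmulr_lge0; last first.
      by apply: powR_gt0; exact: lt_le_trans deltad.
    move=> C0.
    by rewrite !mulr_ge0 // ?powR_ge0.
  apply: geometric_sum_le; rewrite powR_ge0 /=.
  rewrite [ltRHS](_ : 1 = 1 `^ (t - s)); last by rewrite powR1.
  rewrite gt0_ltr_powR ?nnegrE ?subr_gt0 ?invr_ge0 //.
  by rewrite invf_lt1 // ltr1n.
apply: ler_sum => m _.
pose l := [seq i <- J | lev i == m].
have -> : \sum_(i <- J | inord (lev i) == m) (2 * rad i) `^ t =
    \sum_(i <- l) (2 * rad i) `^ t.
  rewrite big_filter [LHS]big_seq_cond [RHS]big_seq_cond.
  apply: eq_bigl => i; case: (boolP (i \in J)) => //= iJ.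
  by rewrite -val_eqE /= inordK // ltnS levM.
have lP i : i \in l -> [/\ D i, q m.+1 < rad i & rad i <= q m].
  rewrite mem_filter => /andP[/eqP <- /JD Di]; split => //.
    by have /andP[] := levP i Di.
  by have /andP[] := levP i Di.
(* Centres at distance at most [q m / (2 * n.+1)] in the supremum norm are at
   Euclidean distance at most [q m / 2], less than the radii; [n.+1] in place of
   [n] keeps the divisor positive. *)
have sizel : (size l)%:R <= C * (q m / (2 * n.+1%:R)) `^ (- s).
  rewrite -(size_map x l); apply: HC.
  - rewrite divr_gt0 //= (@le_trans _ _ (q m)) //.
      rewrite ler_pdivrMr // ler_peMr ?(ltW (q0 _)) //.
      by rewrite -[leLHS]mulr1 ler_pM // ?ler1n // -natr1 lerDr.
    apply: le_trans deltad; rewrite /q -[leRHS]mulr1 ler_pM2l //.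
    by rewrite exprn_ile1 // ?invr_ge0 // invf_le1 // ler1n.
  - rewrite /spaced pairwise_map.
    have : pairwise (fun i j : nat => i != j) l.
      by rewrite -uniq_pairwise filter_uniq.
    have : all (mem l) l by apply/allP.
    apply: sub_in_pairwise => i j /= il jl ij.
    have [Di ri1 _] := lP i il; have [Dj rj1 _] := lP j jl.
    rewrite ltNge; apply/negP => dij.
    suff : (closed_eball (x i) (rad i) `&` closed_eball (x j) (rad j)) (x j).
      by move/trivIsetP: triv => /(_ i j Di Dj ij) ->.
    split; rewrite /closed_eball /=.
      apply: (le_trans (euclidean_dist_le_norm _ _)); apply: le_trans (ltW ri1).
      apply: (@le_trans _ _ (n.+1%:R * (q m / (2 * n.+1%:R)))).
        by rewrite ler_pM // ler_nat.
      rewrite /q exprS le_eqVlt; apply/orP; left; apply/eqP; field.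
      exact: lt0r_neq0.
    apply: (le_trans (euclidean_dist_le_norm _ _)).
    by rewrite subrr normr0 mulr0 (le_trans _ (ltW rj1)) // ltW.
  - by move=> y /mapP[i /lP[Di _ _] ->]; have [] := Dr i Di.
apply: (@le_trans _ _ (\sum_(i <- l) (2 * q m) `^ t)).
  rewrite [leLHS]big_seq [leRHS]big_seq; apply: ler_sum => i /lP[Di _ ri].
  apply: ler_powR_base; rewrite ?ler_pM2l // mulr_ge0 // ltW //.
  by have /andP[] := (Dr i Di).2.
rewrite big_const_seq count_predT iter_addr_0 -[leLHS]mulr_natl.
apply: (@le_trans _ _ (C * (q m / (2 * n.+1%:R)) `^ (- s) * (2 * q m) `^ t)).
  by rewrite ler_wpM2r // powR_ge0.
rewrite le_eqVlt; apply/orP; left; apply/eqP.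
rewrite powRM ?invr_ge0 ?(ltW (q0 _)) ?(ltW n2) //.
rewrite (_ : (2 * n.+1%:R)^-1 = (2 * n.+1%:R) `^ (-1)); last first.
  by rewrite powR_inv1 // ltW.
rewrite -powRrM mulN1r opprK [(2 * q m) `^ t]powRM ?(ltW (q0 _)) //.
have -> : q m `^ t = q m `^ (t - s) * q m `^ s.
  by rewrite -powRD ?subrK // (gt_eqF (q0 _)) implybT.
have half0 : (0 : R) <= 2^-1 by rewrite invr_ge0.
have -> : (2^-1 `^ (t - s)) ^+ m = (2^-1 ^+ m) `^ (t - s) :> R.
  rewrite -powR_mulrn ?powR_ge0 // -powRrM mulrC powRrM powR_mulrn //.
rewrite -[RHS]mulrA -powRM ?(ltW delta0) ?exprn_ge0 // -/(q m) powRN /K.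
by field; rewrite gt_eqF // powR_gt0.
Qed.

Lemma box_bounded_packing_premeasure s t X : s < t -> 0 <= t ->
  box_bounded s X -> packing_premeasure t X = 0%E.
Proof.
move=> st t0 [C [d [d0 HC]]].
apply/eqP; rewrite eq_le packing_premeasure_ge0 andbT.
apply/lee_addgt0Pr => e e0; rewrite add0e.
pose K := C * (2 * n.+1%:R) `^ s * 2 `^ t * (1 - 2^-1 `^ (t - s))^-1.
have K0 : 0 < `|K| + 1 by rewrite ltr_wpDl.
have [||d' d'0 Hd'] := @powR_small R (t - s) (e / (`|K| + 1)).
- by rewrite subr_gt0.
- by rewrite divr_gt0.
pose delta := Num.min d d'.
have delta0 : 0 < delta by rewrite lt_min d0.
apply: ge_ereal_inf; exists (packing_content t delta X).
  by exists delta.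
apply: ge_ereal_sup => _ [D [x [rad [pack ->]]]].
apply: ge_ereal_sup => _ [J [finJ JD] <-].
rewrite fsbig_finite //= sumEFin lee_fin.
apply: (le_trans (packing_sum_le HC st t0 _ pack _ _)).
- by rewrite delta0 ge_min lexx.
- exact: finmap.fset_uniq.
- by move=> i; rewrite in_fset_set // inE => /JD.
rewrite -/K; apply: (@le_trans _ _ ((`|K| + 1) * delta `^ (t - s))).
  by rewrite ler_wpM2r ?powR_ge0 // (le_trans (ler_norm K)) // lerDl.
rewrite mulrC -ler_pdivlMr //; apply: Hd'.
by rewrite (ltW delta0) ge_min lexx orbT.
Qed.

Lemma sigma_box_bounded_packing_measure s t A : s < t -> 0 <= t ->
  sigma_box_bounded s A -> packing_measure t A = 0%E.
Proof.
move=> st t0 [F [AF bF]].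
apply/eqP; rewrite eq_le packing_measure_ge0 andbT.
apply: ge_ereal_inf; exists (\sum_(0 <= i <oo) packing_premeasure t (F i))%E.
  by exists F.
by rewrite eseries0 // => i _ _; exact: (box_bounded_packing_premeasure st).
Qed.

End Packing.

(** * Covering by few translates *)

Section Covering.
Context {R : realType}.

(** Averaging over [V], some set contains at least the proportion [M / #|V|] of
    the points that are still uncovered. *)
Lemma greedy_cover (V U : finType) (c : V -> U -> bool) (M : R) (m : nat) :
  (0 < #|V|)%N -> (forall u, M <= #|[pred v | c v u]|%:R) ->
  exists2 Q : seq V, size Q = m &
    #|[pred u | ~~ has (c^~ u) Q]|%:R <= #|U|%:R * expR (- (m%:R * (M / #|V|%:R))).
Proof.
move=> V0 cM; have V0R : 0 < #|V|%:R :> R by rewrite ltr0n.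
elim: m => [|m [Q sQ IH]].
  exists [::] => //; rewrite mul0r oppr0 expR0 mulr1 ler_nat; exact: max_card.
set un := [pred u | _] in IH.
have [v hv] : exists v, #|un|%:R * (M / #|V|%:R) <= #|[pred u in un | c v u]|%:R.
  apply: contrapT => /forallNP nv.
  have : (\sum_(v : V) #|[pred u in un | c v u]|%:R : R) < #|un|%:R * M.
    have -> : #|un|%:R * M = \sum_(v : V) #|un|%:R * (M / #|V|%:R).
      rewrite sumr_const (eq_card (B := V)) // -[RHS]mulr_natr -mulrA divfK //.
      by rewrite gt_eqF.
    have /card_gt0P[v0 _] := V0.
    rewrite (bigD1 v0) //= [ltRHS](bigD1 v0) //= ltr_leD //.
      by rewrite ltNge; apply/negP.
    by apply: ler_sum => v _; rewrite leNgt; apply/negP => /ltW; exact: nv.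
  apply/negP; rewrite -leNgt.
  have -> : \sum_(v : V) #|[pred u in un | c v u]|%:R =
      \sum_(u in un) #|[pred v | c v u]|%:R :> R.
    rewrite -!natr_sum; congr _%:R.
    under eq_bigr => v _ do rewrite -sum1_card.
    under [RHS]eq_bigr => u _ do rewrite -sum1_card.
    rewrite (exchange_big_dep (mem un)) /= => [|v u _ /andP[]//].
    apply: eq_bigr => u uun; apply: eq_bigl => v.
    by rewrite inE /= -[X in X && _]/(u \in un) uun.
  rewrite mulr_natl -sumr_const; apply: ler_sum => u _; exact: cM.
exists (v :: Q); first by rewrite /= sQ.
have split_un : (#|[pred u | ~~ has (c^~ u) (v :: Q)]| +
    #|[pred u in un | c v u]| = #|un|)%N.
  rewrite addnC -(cardID [pred u | c v u] un); congr addn; apply: eq_card => u.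
  by rewrite !inE /= negb_or.
have := congr1 (fun k => k%:R : R) split_un; rewrite natrD => split_unR.
apply: (@le_trans _ _ (#|un|%:R * (1 - M / #|V|%:R))).
  by rewrite mulrBr mulr1; lra.
apply: (@le_trans _ _ (#|un|%:R * expR (- (M / #|V|%:R)))).
  by rewrite ler_wpM2l // expR_ge1Dx.
rewrite -natr1 mulrDl mul1r opprD expRD mulrA.
by rewrite ler_wpM2r // expR_ge0.
Qed.

(** The Johnson-Stein-Lovasz bound: the greedy choice shrinks the uncovered part
    geometrically, and a part with fewer than one point is empty. *)
Lemma logarithmic_cover (V U : finType) (c : V -> U -> bool) (M : R) (m : nat) :
  (0 < #|V|)%N -> (forall u, M <= #|[pred v | c v u]|%:R) ->
  ln #|U|%:R * #|V|%:R < m%:R * M ->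
  exists2 Q : seq V, size Q = m & forall u, has (c^~ u) Q.
Proof.
move=> V0 cM hm; have [Q sQ unQ] := greedy_cover m V0 cM; exists Q => // u.
have V0R : 0 < #|V|%:R :> R by rewrite ltr0n.
have U0R : 0 < #|U|%:R :> R by rewrite ltr0n; apply/card_gt0P; exists u.
apply/negPn/negP => nu.
have : 1 <= #|[pred u | ~~ has (c^~ u) Q]|%:R :> R.
  by rewrite ler1n; apply/card_gt0P; exists u.
move=> /le_trans /(_ unQ); apply/negP; rewrite -ltNge expRN.
rewrite ltr_pdivrMr ?expR_gt0 // mul1r -[ltLHS]lnK ?posrE // ltr_expR.
by rewrite mulrA ltr_pdivlMr.
Qed.

End Covering.

Section SumsetCover.
Context {R : realType} {n : nat}.

(** After rounding to a grid of mesh [h] this is the finite covering bound: a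
    grid point is reached from [size Ps] different translations, because points
    more than [h] apart round to different ones. *)
Lemma sumset_cover (p q : 'rV[R]_n) (delta h : R) (Ps : seq 'rV[R]_n) (m : nat) :
  0 < h <= delta -> spaced h Ps -> (forall x, x \in Ps -> `|x - p| <= delta) ->
  n%:R * ln (3 * delta / h) * (5 * delta / h) ^+ n < m%:R * (size Ps)%:R ->
  exists Q : seq 'rV[R]_n, [/\ size Q = m,
    forall y, y \in Q -> `|y - q| <= 2 * delta &
    forall z, `|z - (p + q)| <= delta ->
      exists x y, [/\ x \in Ps, y \in Q & `|z - x - y| <= 2 * h]].
Proof.
move=> /andP[h0 hd] sP Pp hm; have d0 : 0 < delta by exact: lt_le_trans hd.
(* Corners of the cube of targets, of side [2 * delta], and of the cube of
   translations, of side [4 * delta]. *)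
pose z0 : 'rV[R]_n := p + q - const_mx delta.
pose q0 : 'rV[R]_n := q - const_mx (2 * delta).
have d2 : 0 <= 2 * delta by rewrite mulr_ge0 // ltW.
have d4 : 0 <= 4 * delta by rewrite mulr_ge0 // ltW.
pose U : finType := {ffun 'I_n -> 'I_(Num.truncn (2 * delta / h)).+1}.
pose V : finType := {ffun 'I_n -> 'I_(Num.truncn (4 * delta / h)).+1}.
pose off (u : U) x := z0 + grid_point h u - x - q0.
pose c (v : V) (u : U) := has (fun x => `|off u x - grid_point h v| <= h) Ps.
have offP u x : x \in Ps -> forall i, 0 <= off u x ord0 i <= 4 * delta.
  move=> xP i; have := grid_point_itv u i h0 d2.
  have := le_trans (coord_le_norm _ i) (Pp _ xP).
  rewrite !mxE ler_norml; set g := _%:R * h; set a := p _ _; set b := q _ _.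
  by set e := x _ _; move=> /andP[? ?] /andP[? ?]; apply/andP; split; lra.
have cM u : (size Ps)%:R <= #|[pred v | c v u]|%:R :> R.
  pose f x : V := grid_cell h (Num.truncn (4 * delta / h)) (off u x).
  have finj : {in Ps &, injective f}.
    move=> x y xP yP fxy; apply: (spacedP (ltW h0) sP) => //.
    have := grid_cell_eq h0 (offP u x xP) (offP u y yP) fxy.
    rewrite distrC /off; congr (`|_| <= _); apply/rowP => i; rewrite !mxE; ring.
  rewrite ler_nat -(size_map f) -(card_uniqP _); last first.
    by rewrite map_inj_in_uniq // (spaced_uniq (ltW h0)).
  apply: subset_leq_card; apply/fintype.subsetP => _ /mapP[x xP ->]; rewrite inE.
  by apply/hasP; exists x => //; apply: grid_cell_near => //; exact: offP.
have U0 : 0 < #|U|%:R :> R by rewrite card_ffun card_ord ltr0n expn_gt0.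
have V0 : (0 < #|V|)%N by rewrite card_ffun card_ord expn_gt0.
have dh1 : 1 <= delta / h by rewrite ler_pdivlMr // mul1r.
have [|Q sQ covQ] := @logarithmic_cover R V U c (size Ps)%:R m V0 cM.
  apply: le_lt_trans hm; apply: ler_pM => //.
  - by rewrite ln_ge0 // ler1n card_ffun card_ord expn_gt0.
  - have dh3 : 0 < 3 * delta / h by rewrite -mulrA; lra.
    rewrite mulr_natl -lnXn // ler_ln ?posrE ?exprn_gt0 //.
    apply: (le_trans (card_grid h0 d2)).
    by rewrite lerXn2r ?nnegrE -?mulrA; lra.
  - apply: (le_trans (card_grid h0 d4)).
    by rewrite lerXn2r ?nnegrE -?mulrA; lra.
exists [seq q0 + grid_point h v | v <- Q]; split.
- by rewrite size_map.
- move=> _ /mapP[v _ ->]; apply: norm_le_coord => // i.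
  have := grid_point_itv v i h0 d4; rewrite !mxE ler_norml.
  by set g := _%:R * h; move=> /andP[? ?]; apply/andP; split; lra.
- move=> z zpq.
  have zi i : 0 <= (z - z0) ord0 i <= 2 * delta.
    have := le_trans (coord_le_norm _ i) zpq; rewrite !mxE ler_norml.
    by move=> /andP[? ?]; apply/andP; split; lra.
  pose u : U := grid_cell h (Num.truncn (2 * delta / h)) (z - z0).
  have /hasP[v vQ /hasP[x xP xv]] := covQ u.
  exists x, (q0 + grid_point h v); split => //; first exact: map_f.
  have := grid_cell_near h0 zi; rewrite -/u => zu.
  have := ler_normD (z - z0 - grid_point h u) (off u x - grid_point h v).
  have -> : z - z0 - grid_point h u + (off u x - grid_point h v) =
      z - x - (q0 + grid_point h v).
    by apply/rowP => i; rewrite !mxE; ring.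
  lra.
Qed.

(** The logarithmic loss in the number of translations is absorbed by the gap
    between [t] and the codimension [n - s]. *)
Lemma translation_count (s t delta eta : R) :
  0 < t -> n%:R - s < t -> 0 < delta -> 0 < eta ->
  exists2 d, 0 < d & forall h (N : nat), 0 < h <= d -> h `^ (- s) < N%:R ->
    exists m : nat,
      n%:R * ln (3 * delta / h) * (5 * delta / h) ^+ n < m%:R * N%:R /\
      m%:R * (2 * h) `^ t <= eta.
Proof.
move=> t0 nst d0 eta0; pose e := (t - (n%:R - s)) / 2.
have e0 : 0 < e by rewrite divr_gt0 // subr_gt0.
pose K := n%:R * ((3 * delta) `^ e / e) * (5 * delta) ^+ n * 2 `^ t.
have K0 : 0 <= K.
  by rewrite !mulr_ge0 ?invr_ge0 ?powR_ge0 ?exprn_ge0 ?(ltW e0) // mulr_ge0 // ltW.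
have T0 : 0 < 2 `^ t :> R by rewrite powR_gt0.
have [||d1 d10 Hd1] := @powR_small R e (eta / 2 / (K + 1)) => //.
  by rewrite !divr_gt0 // ltr_wpDl.
have [||d2 d20 Hd2] := @powR_small R t (eta / 2 / 2 `^ t) => //.
  by rewrite !divr_gt0.
exists (Num.min d1 d2); first by rewrite lt_min d10.
move=> h N /andP[h0]; rewrite le_min => /andP[hd1 hd2] hN.
have {}Hd1 := Hd1 h; rewrite (ltW h0) hd1 in Hd1.
have {}Hd2 := Hd2 h; rewrite (ltW h0) hd2 in Hd2.
have N0 : 0 < N%:R :> R by apply: le_lt_trans hN; exact: powR_ge0.
pose Y := n%:R * ln (3 * delta / h) * (5 * delta / h) ^+ n.
have [Y0|Y0] := leP 0 Y; last first.
  by exists 0%N; rewrite !mul0r ltW.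
exists (Num.truncn (Y / N%:R)).+1; split.
  by rewrite -ltr_pdivrMr // truncnS_gt.
have YN : Y / N%:R <= n%:R * ((3 * delta) `^ e / e) * (5 * delta) ^+ n * h `^ (e - t).
  apply: (@le_trans _ _ (Y * h `^ s)).
    rewrite ler_wpM2l // -[leRHS]invrK -powRN lef_pV2 ?posrE ?powR_gt0 //.
    exact: ltW.
  have -> : h `^ (e - t) = h `^ (- e) * h `^ (- n%:R) * h `^ s.
    by rewrite -!powRD ?(gt_eqF h0) ?implybT //; congr (_ `^ _); rewrite /e; field.
  rewrite [h `^ (- n%:R)]powRN powR_mulrn ?(ltW h0) // !mulrA ler_wpM2r ?powR_ge0 //.
  rewrite /Y exprMn exprVn mulrA ler_wpM2r ?invr_ge0 ?exprn_ge0 ?(ltW h0) //.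
  rewrite [leRHS]mulrAC ler_wpM2r ?exprn_ge0 // ?mulr_ge0 ?(ltW d0) //.
  have d3 : 0 < 3 * delta by rewrite mulr_gt0.
  by have := ler_wpM2l (ler0n R n) (ln_div_le_powR h0 d3 e0); rewrite !mulrA.
rewrite -natr1 mulrDl mul1r (splitr eta).
have h2 : (2 * h) `^ t = 2 `^ t * h `^ t by rewrite powRM // ltW.
apply: lerD.
  apply: (@le_trans _ _ (Y / N%:R * (2 * h) `^ t)).
    by rewrite ler_wpM2r ?powR_ge0 // truncn_le divr_ge0.
  apply: (@le_trans _ _ (K * h `^ e)).
    rewrite h2; have -> : h `^ e = h `^ (e - t) * h `^ t.
      by rewrite -powRD ?subrK // (gt_eqF h0) implybT.
    have := ler_wpM2r (ltW (powR_gt0 t h0)) (ler_wpM2r (ltW T0) YN).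
    by rewrite /K; move: (Y / _) (h `^ (e - t)) (h `^ t) (2 `^ t) => *; lra.
  apply: (@le_trans _ _ ((K + 1) * h `^ e)).
    by rewrite ler_wpM2r ?powR_ge0 // lerDl.
  by rewrite mulrC -ler_pdivlMr ?ltr_wpDl // Hd1.
by rewrite h2 mulrC -ler_pdivlMr // Hd2.
Qed.

End SumsetCover.

(** * Borel sets as Suslin sets *)

Section Suslin.
Context {T : topologicalType}.
Implicit Types X : set T.

(** A countably branching tree of sets with root [X] whose branches cannot leave
    [X] in the limit. The nodes are states of a transition system instead of
    finite sequences of integers, which makes products of trees immediate. *)
Record suslin_scheme X := SuslinScheme {
  sch_state : Type;
  sch_root : sch_state;
  sch_step : sch_state -> nat -> sch_state;
  sch_set : sch_state -> set T;
  sch_set_root : sch_set sch_root = X;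
  sch_set_step : forall u, sch_set u = \bigcup_i sch_set (sch_step u i);
  sch_limit : forall path : nat -> sch_state, path 0%N = sch_root ->
    (forall k, exists i, path k.+1 = sch_step (path k) i) ->
    \bigcap_k closure (sch_set (path k)) `<=` X }.

Definition suslin X := inhabited (suslin_scheme X).

Lemma suslin_closed X : closed X -> suslin X.
Proof.
move=> cX; split.
apply: (@SuslinScheme X unit tt (fun _ _ => tt) (fun=> X)) => //.
  by move=> _; apply/seteqP; split => [x Xx|x [_ _]//]; exists 0%N.
by move=> path _ _ x /(_ 0%N I); exact: cX.
Qed.

Lemma suslin_choice (X : nat -> set T) : (forall j, suslin (X j)) ->
  inhabited (forall j, suslin_scheme (X j)).
Proof.
move=> sX; split => j; apply: (projT1 (cid _)).
by case: (sX j) => s; exists s.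
Qed.

Lemma suslin_bigcup (X : nat -> set T) :
  (forall j, suslin (X j)) -> suslin (\bigcup_j X j).
Proof.
move=> /suslin_choice[sch]; split.
pose st := option (nat * forall j : nat, sch_state (sch j)).
pose stp (u : st) i : st := match u with
  | None => Some (i, fun j => sch_root (sch j))
  | Some (j, f) => Some (j, fun j => sch_step (f j) i)
  end.
pose vl (u : st) := match u with
  | None => \bigcup_j X j
  | Some (j, f) => sch_set (f j)
  end.
apply: (@SuslinScheme _ st None stp vl) => //.
  case=> [[j f]|] /=; first exact: sch_set_step.
  by apply: eq_bigcupr => i _; rewrite sch_set_root.
move=> path path0 pathS x xpath.
have [j pathj] := pathS 0%N; rewrite path0 /= in pathj.
have /choice[sub subP] k : exists f, path k.+1 = Some (j, f).
  elim: k => [|k [f pk]]; first by exists (fun j => sch_root (sch j)).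
  by have [i ->] := pathS k.+1; rewrite pk /=; exists (fun j => sch_step (f j) i).
exists j => //; apply: (@sch_limit _ (sch j) (fun k => sub k j)).
- by have := subP 0%N; rewrite pathj => -[<-].
- by move=> k; have [i] := pathS k.+1; rewrite !subP /= => -[->]; exists i.
- by move=> k _; have := xpath k.+1 I; rewrite subP.
Qed.

(** At time [k] the product tree moves in its first [k + 1] factors, by a code of
    the finite sequence of moves; every factor is then followed from some time
    on, so a branch of the product contains a branch of each factor. *)
Lemma suslin_bigcap (X : nat -> set T) :
  (forall j, suslin (X j)) -> suslin (\bigcap_j X j).
Proof.
move=> /suslin_choice[sch]; split.
pose st := (nat * forall j : nat, sch_state (sch j))%type.
pose stp (u : st) i : st := (u.1.+1, fun j : nat =>
  if (j <= u.1)%N then sch_step (u.2 j) (nth 0%N (CodeSeq.decode i) j) else u.2 j).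
pose vl (u : st) := \bigcap_j sch_set (u.2 j).
apply: (@SuslinScheme _ st (0%N, fun j => sch_root (sch j)) stp vl).
- by apply: eq_bigcapr => j _; exact: sch_set_root.
- move=> [k f]; apply/seteqP; split=> [x xf|x [i _ xi]]; last first.
    move=> j _; have /= := xi j I; case: ifP => // _ xj.
    by rewrite sch_set_step; exists (nth 0%N (CodeSeq.decode i) j).
  have /choice[m mP] j : exists m, sch_set (sch_step (f j) m) x.
    by have := xf j I; rewrite /= sch_set_step => -[m _ ?]; exists m.
  have [c cK] : exists c, CodeSeq.decode c = mkseq m k.+1.
    by exists (CodeSeq.code (mkseq m k.+1)); exact: CodeSeq.codeK.
  exists c => // j _ /=; case: ifPn => [jk|_]; last exact: xf.
  by rewrite cK nth_mkseq.
- move=> path path0 pathS x xpath j _.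
  have time k : (path k).1 = k.
    by elim: k => [|k IH]; [rewrite path0|have [i ->] := pathS k; rewrite /= IH].
  apply: (@sch_limit _ (sch j) (fun m => (path (m + j)%N).2 j)).
  + suff wait k : (k <= j)%N -> (path k).2 j = sch_root (sch j) by exact: wait.
    elim: k => [|k IH] kj; first by rewrite path0.
    have [i ->] := pathS k; rewrite /= time leqNgt kj /=.
    by apply: IH; exact: ltnW.
  + move=> k; have [i pk] := pathS (k + j)%N.
    rewrite addSn pk /= time leq_addl.
    by exists (nth 0%N (CodeSeq.decode i) j).
  + move=> k _; apply: closureS (xpath (k + j)%N I).
    by move=> y; apply.
Qed.

End Suslin.

Section BorelSuslin.
Context {R : realType} {V : normedModType R}.
Implicit Types X : set V.

Lemma suslin_open X : open X -> suslin X.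
Proof.
(* The points at distance at least [1 / k.+1] from the complement form a closed
   set. *)
move=> oX; pose C (k : nat) : set V :=
  [set x | forall y, `|x - y| < k.+1%:R^-1 -> X y].
have -> : X = \bigcup_k C k.
  apply/seteqP; split=> [x Xx|x [k _ Ck]]; last first.
    by apply: Ck; rewrite subrr normr0 invr_gt0.
  have /nbhs_ballP[e /= e0 xe] : nbhs x X by exact: open_nbhs_nbhs.
  have [k ke] : exists k : nat, k.+1%:R^-1 < e.
    exists (Num.truncn e^-1); rewrite invf_plt ?posrE //; exact: truncnS_gt.
  exists k => // y xy; apply: xe; rewrite -ball_normE /=.
  exact: lt_trans ke.
apply: suslin_bigcup => k; apply: suslin_closed => x clx y xy.
have /clx[x' [/= Cx']] : nbhs x (ball x (k.+1%:R^-1 - `|x - y|)).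
  by apply: nbhsx_ballx; rewrite subr_gt0.
rewrite -ball_normE /= => xx'; apply: Cx'.
move: xx'; rewrite ltrBrDr distrC; apply: le_lt_trans.
exact: ler_distD.
Qed.

(** The sets that are Suslin together with their complement form a
    sigma-algebra, since Suslin sets are stable under countable unions and
    countable intersections. *)
Lemma borel_suslin X : <<s @open V >> X -> suslin X.
Proof.
suff sub : <<s @open V >> `<=` [set Y | suslin Y /\ suslin (~` Y)].
  by move=> /sub[].
apply: smallest_sub; last first.
  move=> Y oY; split; first exact: suslin_open.
  by apply: suslin_closed; exact: open_closedC.
split.
- split; first by apply: suslin_closed; exact: closed0.
  by rewrite setC0; apply: suslin_closed; exact: closedT.
- by move=> Y [sY sCY]; rewrite /= setTD setCK.
- move=> F sF; split; first by apply: suslin_bigcup => j; exact: (sF j).1.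
  by rewrite setC_bigcup; apply: suslin_bigcap => j; exact: (sF j).2.
Qed.

End BorelSuslin.

(** * Thick points *)

Section Thick.
Context {R : realType} {n : nat}.
Implicit Types (X : set 'rV[R]_n) (x y p : 'rV[R]_n) (s r : R).

(** No neighbourhood of [p] loses the largeness of [X]: the points at which a
    construction inside [X] can be continued. *)
Definition thick s X p :=
  forall r, 0 < r -> ~ sigma_box_bounded s (X `&` cube p r).

Lemma thick_closure s X p : thick s X p -> closure X p.
Proof.
move=> thp U /nbhs_ballP[e /= e0 eU].
have e20 : 0 < e / 2 by rewrite divr_gt0.
apply: contrapT => XU; apply: (thp _ e20).
apply: (@sigma_box_bounded_sub _ _ _ _ set0); last first.
  exact/box_bounded_sigma/box_bounded_set0.
move=> y [Xy yp]; apply: XU; exists y; split => //; apply: eU.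
by rewrite -ball_normE /= distrC (le_lt_trans yp) // ltr_pdivrMr // ltr_pMr ?ltr1n.
Qed.

(** The lattice cubes form a countable base, and a non-thick point lies in one
    whose trace on [X] is small. *)
Lemma sigma_box_bounded_nonthick s X :
  sigma_box_bounded s (X `&` [set p | ~ thick s X p]).
Proof.
pose C (i : nat * 'rV[int]_n) :=
  X `&` cube (lattice_point i.1.+1%:R^-1 i.2) i.1.+1%:R^-1.
pose F i := if `[< sigma_box_bounded s (C i) >] then C i else set0.
apply: (@sigma_box_bounded_sub _ _ _ _ (\bigcup_i F i)); last first.
  apply: sigma_box_bounded_bigcup => i; rewrite /F; case: asboolP => //.
  by move=> _; exact/box_bounded_sigma/box_bounded_set0.
move=> x [Xx /= /existsNP[r /not_implyP[r0 /contrapT br]]].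
have [k kr] : exists k : nat, k.+1%:R^-1 < r / 2.
  exists (Num.truncn (r / 2)^-1); rewrite invf_plt ?posrE ?divr_gt0 //.
  exact: truncnS_gt.
have k0 : (0 : R) < k.+1%:R^-1 by rewrite invr_gt0.
have [g xg] := lattice_near x k0; exists (k, g) => //; rewrite /F.
case: asboolP => [_|[]]; first by split.
apply: sigma_box_bounded_sub br => y [Xy yg]; split => //.
have := ler_distD (lattice_point k.+1%:R^-1 g) y x.
move: xg yg; rewrite /cube /= [`|x - _|]distrC.
move: (_^-1) kr (lattice_point _ _) => e ? ?; lra.
Qed.

End Thick.

(** * The compact summand *)

Section Tree.
Context {R : realType} {n : nat} {A : set 'rV[R]_n} (sch : suslin_scheme A).
Context (s t : R) (t0 : 0 < t) (nst : n%:R - s < t).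

Definition node_set (sg : seq nat) : set 'rV[R]_n :=
  sch_set (foldl (@sch_step _ _ sch) (sch_root sch) sg).

Lemma node_set_rcons sg : node_set sg = \bigcup_i node_set (rcons sg i).
Proof.
rewrite {1}/node_set sch_set_step; apply: eq_bigcupr => i _.
by rewrite /node_set foldl_rcons.
Qed.

(** Near a thick point of a node the thick points of its children are still not
    box-bounded, so at arbitrarily small scales [h] there are more than
    [h `^ (- s)] separated ones. Then about [h `^ (s - n)] translations reach a
    whole cube, and [t] exceeds [n - s]. *)
Lemma thick_step sg (p q : 'rV[R]_n) (delta eta : R) :
  thick s (node_set sg) p -> 0 < delta -> 0 < eta ->
  exists (Ps Qs : seq 'rV[R]_n) (r : R),
  [/\ [/\ 0 < r, r <= delta / 2, r <= eta & (size Qs)%:R * r `^ t <= eta],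
    forall x, x \in Ps -> `|x - p| <= delta /\
      exists j, thick s (node_set (rcons sg j)) x,
    forall y, y \in Qs -> `|y - q| <= 2 * delta &
    forall z, `|z - (p + q)| <= delta ->
      exists x y, [/\ x \in Ps, y \in Qs & `|z - x - y| <= r]].
Proof.
move=> thp delta0 eta0.
have [d d0 Hd] := translation_count t0 nst delta0 eta0.
pose X' := cube p delta `&`
  [set x | exists j, thick s (node_set (rcons sg j)) x].
have nbX' : ~ box_bounded s X'.
  move=> bX'; apply: (thp _ delta0).
  pose N j := node_set (rcons sg j).
  apply: (@sigma_box_bounded_sub _ _ _ _
      (X' `|` \bigcup_j (N j `&` [set x | ~ thick s (N j) x]))).
    move=> x [/=]; rewrite node_set_rcons => -[j _ xj] xp.
    have [th|nth] := pselect (thick s (N j) x).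
      by left; split => //; exists j.
    by right; exists j.
  apply: sigma_box_boundedU; first exact: box_bounded_sigma.
  apply: sigma_box_bounded_bigcup => j; exact: sigma_box_bounded_nonthick.
pose e := Num.min d (Num.min (delta / 4) (eta / 2)).
have e0 : 0 < e by rewrite !lt_min d0 !divr_gt0.
have [h [Ps [h0e sP PX' sizeP]]] : exists h Ps, [/\ 0 < h <= e, spaced h Ps,
    forall x, x \in Ps -> X' x & h `^ (- s) < (size Ps)%:R].
  apply: contrapT => noP; apply: nbX'; exists 1, e; split => // r l re sl lX.
  rewrite mul1r leNgt; apply/negP => lt1; apply: noP; exists r, l; split => //.
move: h0e; rewrite !le_min => /and4P[h0 hd h4 h2].
have [|m [m1 m2]] := Hd h (size Ps) _ sizeP; first by rewrite h0.
have [||Qs [sQ Qq cov]] := sumset_cover (p := p) q _ sP _ m1.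
- by rewrite h0 /=; lra.
- by move=> x /PX'[].
exists Ps, Qs, (2 * h); split => //.
by split; [rewrite mulr_gt0|lra|lra|rewrite sQ].
Qed.

(** A partial choice of a point of [A] near [nd_p], inside the node [nd_path] of
    the scheme, and of a point of the other summand near [nd_q]; the sum is known
    up to [nd_r]. *)
Definition node := (seq nat * 'rV[R]_n * 'rV[R]_n * R)%type.
Definition nd_path (v : node) := v.1.1.1.
Definition nd_p (v : node) := v.1.1.2.
Definition nd_q (v : node) := v.1.2.
Definition nd_r (v : node) := v.2.

Definition good_node (v : node) :=
  thick s (node_set (nd_path v)) (nd_p v) /\ 0 < nd_r v.

(** The children [L] of a node are pairs, but only the distinct second
    components, listed in [C], enter the sum that bounds the other summand:
    counting pairs would lose the gain over [n]. *)
Definition refines (v : node) (eta : R) (L : seq node) (C : seq ('rV[R]_n * R)) :=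
  [/\ forall w, w \in L ->
        [/\ good_node w, exists j, nd_path w = rcons (nd_path v) j,
            `|nd_p w - nd_p v| <= nd_r v, `|nd_q w - nd_q v| <= 2 * nd_r v &
            nd_r w <= nd_r v / 2 /\ nd_r w <= eta /\ (nd_q w, nd_r w) \in C],
      forall z, `|z - nd_p v - nd_q v| <= nd_r v ->
        exists2 w, w \in L & `|z - nd_p w - nd_q w| <= nd_r w,
      forall c, c \in C -> 0 < c.2 <= eta &
      \sum_(c <- C) c.2 `^ t <= eta].

Lemma refinement_exists v eta : good_node v -> 0 < eta ->
  exists LC : seq node * seq ('rV[R]_n * R), refines v eta LC.1 LC.2.
Proof.
move=> [thv r0] eta0.
have [Ps [Qs [r [[r'0 rv re sumQ] PsP QsP cov]]]] :=
  thick_step (nd_q v) thv r0 eta0.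
have /choice[nx nxP] x : exists j, x \in Ps ->
    thick s (node_set (rcons (nd_path v) j)) x.
  have [/PsP[_ [j thj]]|] := boolP (x \in Ps); first by exists j.
  by exists 0%N.
exists ([seq (rcons (nd_path v) (nx x), x, y, r) | x <- Ps, y <- Qs],
        [seq (y, r) | y <- Qs]); split.
- move=> w /allpairsP[[x y] [/= xP yQ ->]]; split => //=.
  + by split => //=; exact: nxP.
  + by exists (nx x).
  + by have [] := PsP x xP.
  + exact: QsP.
  + by split => //; split => //; exact: map_f.
- move=> z; rewrite -addrA -opprD => /cov[x [y [xP yQ zxy]]].
  exists (rcons (nd_path v) (nx x), x, y, r) => //.
  by apply/allpairsP; exists (x, y).
- by move=> _ /mapP[y _ ->] /=; rewrite r'0.
- by rewrite big_map /= big_const_seq count_predT iter_addr_0 -[leLHS]mulr_natl.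
Qed.

Lemma refinement_function : exists rf : node -> R -> seq node * seq ('rV[R]_n * R),
  forall v eta, good_node v -> 0 < eta -> refines v eta (rf v eta).1 (rf v eta).2.
Proof.
have /choice[rf rfP] (ve : node * R) :
    exists LC : seq node * seq ('rV[R]_n * R),
      good_node ve.1 -> 0 < ve.2 -> refines ve.1 ve.2 LC.1 LC.2.
  have [[g e0]|h] := pselect (good_node ve.1 /\ 0 < ve.2).
    by have [LC LCP] := refinement_exists g e0; exists LC.
  by exists ([::], [::]) => g e0; case: h.
by exists (fun v eta => rf (v, eta)) => v eta g e0; exact: (rfP (v, eta)).
Qed.

End Tree.

Section Summand.
Context {R : realType} {n : nat}.

(** A finitary form of zero [t]-dimensional Hausdorff measure, free of infinite
    sums. *)
Definition thin (t : R) (B : set 'rV[R]_n) := forall eta, 0 < eta ->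
  exists L : seq ('rV[R]_n * R), [/\ forall c, c \in L -> 0 < c.2 <= eta,
    \sum_(c <- L) c.2 `^ t <= eta &
    forall b, B b -> exists2 c, c \in L & cube c.1 c.2 b].

(** The levels of the tree of nodes are finite, and the scale of a refinement is
    chosen after the size of its level is known, so each level is covered with a
    small sum. A target [z] is followed along one branch of the tree; both
    components of that branch converge, the first to a point of [A] because the
    scheme keeps limits of branches inside [A]. *)
Lemma thin_summand (A : set 'rV[R]_n) (s t : R) : suslin A ->
  0 < t -> n%:R - s < t -> ~ sigma_box_bounded s A ->
  exists (B : set 'rV[R]_n) z d, [/\ compact B, thin t B, 0 < d &
    cube z d `<=` minkowski_sum A B].
Proof.
move=> [sch] t0 nst nA.
have [p0 thp0] : exists p0, thick s A p0.
  apply: contrapT => /forallNP noth; apply: nA.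
  apply: sigma_box_bounded_sub (sigma_box_bounded_nonthick s A).
  by move=> x Ax; split => //; exact: noth.
have [rf rfP] := refinement_function sch t0 nst.
pose v0 : node := ([::], p0, 0, 1).
pose eta (k : nat) (L : seq (@node R n)) : R := 2^-1 ^+ k / (size L).+1%:R.
have eta0 k L : 0 < eta k L by rewrite divr_gt0 // exprn_gt0 // invr_gt0.
pose refine k L := flatten [seq (rf v (eta k L)).1 | v <- L].
pose level := fix level k := if k is k'.+1 then refine k' (level k') else [:: v0].
pose C k := flatten [seq (rf v (eta k (level k))).2 | v <- level k].
have good k v : v \in level k -> good_node sch s v.
  elim: k v => [|k IH] v /=.
    rewrite inE => /eqP ->; split => //=.
    by rewrite /node_set /= sch_set_root.
  move=> /flatten_mapP[w wk vw].
  by have [/(_ v vw)[]] := rfP w _ (IH w wk) (eta0 k (level k)).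
have ref k v (vk : v \in level k) := rfP v _ (good k v vk) (eta0 k (level k)).
have eta_le k : eta k (level k) <= 2^-1 ^+ k.
  by rewrite ler_pdivrMr // ler_peMr ?exprn_ge0 ?invr_ge0 // ler1n.
(* Along a branch the second component moves by at most twice the current radius
   and the radii are halved, so its limit stays within four radii. *)
pose E k : set 'rV[R]_n := \big[setU/set0]_(c <- C k) cube c.1 (4 * c.2).
have Ecompact k : compact (E k).
  by apply: bigsetU_compact => c _; exact: compact_cube.
have EP k y : E k y <-> exists2 c, c \in C k & cube c.1 (4 * c.2) y.
  by rewrite /E -bigcup_seq; split => -[c /= cC yc]; exists c.
have Eclosed k : closed (E k).
  by rewrite /E -bigcup_seq; apply: closed_bigcup => // c _; exact: closed_cube.
have CP k c : c \in C k -> 0 < c.2 <= 2^-1 ^+ k.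
  move=> /flatten_mapP[v vk cv]; have [_ _ /(_ c cv)/andP[-> ce] _] := ref k v vk.
  exact: le_trans ce (eta_le k).
have sumC k : \sum_(c <- C k) c.2 `^ t <= 2^-1 ^+ k.
  rewrite big_flatten /= big_map.
  apply: (@le_trans _ _ (\sum_(v <- level k) eta k (level k))).
    rewrite [leLHS]big_seq [leRHS]big_seq; apply: ler_sum => v vk.
    by have [_ _ _] := ref k v vk.
  rewrite big_const_seq count_predT iter_addr_0 -[leLHS]mulr_natr /eta.
  rewrite mulrAC ler_pdivrMr // ler_wpM2l ?exprn_ge0 ?invr_ge0 //.
  by rewrite ler_nat.
exists (\bigcap_k E k), p0, 1; split => //.
- apply: (subclosed_compact _ (Ecompact 0%N)); first exact: closed_bigI.
  by move=> y /(_ 0%N I).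
- move=> e e0; have t40 : 0 < 4 `^ t :> R by rewrite powR_gt0.
  have [k k4 kt] : exists2 k, 4 * 2^-1 ^+ k <= e & 4 `^ t * 2^-1 ^+ k <= e.
    pose m := Num.min (e / 4) (e / 4 `^ t).
    have m0 : 0 < m by rewrite lt_min !divr_gt0.
    have [k km] := half_pow_small m0; exists k; rewrite mulrC -ler_pdivlMr //;
      by apply: (le_trans km); rewrite ge_min lexx ?orbT.
  exists [seq (c.1, 4 * c.2) | c <- C k]; split.
  + move=> _ /mapP[c /CP/andP[c0 ck] ->] /=; rewrite mulr_gt0 //=.
    by apply: le_trans k4; rewrite ler_pM2l.
  + rewrite big_map /=; apply: le_trans kt.
    apply: (@le_trans _ _ (\sum_(c <- C k) 4 `^ t * c.2 `^ t)).
      rewrite [leLHS]big_seq [leRHS]big_seq; apply: ler_sum => c /CP/andP[c0 _].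
      by rewrite powRM // ltW.
    by rewrite -mulr_sumr ler_pM2l.
  + move=> b /(_ k I)/EP[c cC bc]; exists (c.1, 4 * c.2) => //.
    exact: (map_f (fun c => (c.1, 4 * c.2))).
- move=> z zp0.
  pose near (v : @node R n) := `|z - nd_p v - nd_q v| <= nd_r v.
  have /choice[nx nxP] (kv : nat * @node R n) : exists w,
      kv.2 \in level kv.1 -> near kv.2 ->
      w \in (rf kv.2 (eta kv.1 (level kv.1))).1 /\ near w.
    have [[vk nv]|h] := pselect (kv.2 \in level kv.1 /\ near kv.2); last first.
      by exists v0 => vk nv; case: h.
    have [_ /(_ z nv)[w wL nw] _ _] := ref _ _ vk.
    by exists w.
  pose path := fix path k := if k is k'.+1 then nx (k', path k') else v0.
  have pathP k : path k \in level k /\ near (path k).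
    elim: k => [|k [pk nk]].
      by rewrite /= inE eqxx /near /= subr0.
    have [wL nw] := nxP (k, path k) pk nk; split => //=.
    by apply/flatten_mapP; exists (path k).
  have pathS k : path k.+1 \in (rf (path k) (eta k (level k))).1.
    by have [pk nk] := pathP k; have [] := nxP (k, path k) pk nk.
  have step_ref k := ref k _ (pathP k).1.
  pose r k := nd_r (path k).
  have r_ge0 k : 0 <= r k by have [_ /ltW] := good k _ (pathP k).1.
  have rS k : r k.+1 <= r k / 2.
    by have [/(_ _ (pathS k))[_ _ _ _ []]] := step_ref k.
  have [p pP] : exists l, forall k, `|l - nd_p (path k)| <= 2 * 1 * r k.
    apply: shrinking_limit => // k; rewrite mul1r.
    by have [/(_ _ (pathS k))[]] := step_ref k.
  have [q qP] : exists l, forall k, `|l - nd_q (path k)| <= 2 * 2 * r k.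
    apply: shrinking_limit => // k.
    by have [/(_ _ (pathS k))[]] := step_ref k.
  have r_small k : r k.+1 <= 2^-1 ^+ k.
    have [/(_ _ (pathS k))[_ _ _ _ [_ [re _]]] _ _ _] := step_ref k.
    exact: le_trans re (eta_le k).
  have r_lim k (e : R) : 0 < e -> exists m, r (k + m)%N <= e.
    move=> /half_pow_small[m me]; exists m.+1; rewrite addnS.
    apply: le_trans me; apply: (le_trans (r_small _)).
    by rewrite exprD ler_piMl ?exprn_ge0 ?exprn_ile1 ?invr_ge0 // invf_le1 ?ler1n.
  have Ap : A p.
    apply: (@sch_limit _ _ sch
      (fun k => foldl (@sch_step _ _ sch) (sch_root sch) (nd_path (path k)))) => //.
      move=> k; have [/(_ _ (pathS k))[_ [j ->] _ _ _] _ _ _] := step_ref k.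
      by exists j; rewrite foldl_rcons.
    move=> k _ U /nbhs_ballP[e /= e0 eU].
    have mono m : node_set sch (nd_path (path (k + m)%N)) `<=`
        node_set sch (nd_path (path k)).
      elim: m => [|m IH]; first by rewrite addn0.
      apply: subset_trans IH; rewrite addnS.
      have [/(_ _ (pathS (k + m)%N))[_ [j ->] _ _ _] _ _ _] := step_ref (k + m)%N.
      by rewrite [X in _ `<=` X]node_set_rcons => x xj; exists j.
    have e80 : 0 < e / 8 by rewrite divr_gt0.
    have [m rm] := r_lim k _ e80.
    have [thp _] := good _ _ (pathP (k + m)%N).1.
    have /(thick_closure thp)[y [yN]] :
        nbhs (nd_p (path (k + m)%N)) (ball (nd_p (path (k + m)%N)) (e / 4)).
      by apply: nbhsx_ballx; rewrite divr_gt0.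
    rewrite -ball_normE /= => yp; exists y; split; first exact: mono yN.
    apply: eU; rewrite -ball_normE /=.
    have := ler_distD (nd_p (path (k + m)%N)) p y; have := pP (k + m)%N; lra.
  exists p => //; exists q.
    move=> k _; apply/EP; exists (nd_q (path k.+1), nd_r (path k.+1)).
      have [/(_ _ (pathS k))[_ _ _ _ [_ [_ wC]]] _ _ _] := step_ref k.
      by apply/flatten_mapP; exists (path k) => //; exact: (pathP k).1.
    by have := qP k.+1; rewrite /cube /= /r; lra.
  apply/esym/eqP; rewrite -subr_eq0 -normr_le0; apply/ler_addgt0Pr => e e0.
  rewrite add0r; have e70 : 0 < e / 7 by rewrite divr_gt0.
  have [k] := r_lim 0%N _ e70; rewrite add0n => rk.
  have -> : z - (p + q) = (z - nd_p (path k) - nd_q (path k)) +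
      - ((p - nd_p (path k)) + (q - nd_q (path k))).
    by apply/rowP => i; rewrite !mxE; ring.
  apply: (le_trans (ler_normD _ _)); rewrite normrN.
  have := ler_normD (p - nd_p (path k)) (q - nd_q (path k)).
  have [_] := pathP k; rewrite /near -/(r k).
  have := pP k; have := qP k; lra.
Qed.

End Summand.

(** * Sets of Hausdorff measure zero *)

Section HausdorffNull.
Context {R : realType} {n : nat}.
Implicit Types (X B E : set 'rV[R]_n) (s t d r : R) (x y : 'rV[R]_n).

Lemma diameter_ge0 X : (0 <= diameter X)%E.
Proof. by rewrite /diameter le_max lexx. Qed.

Lemma diameter_set0 : diameter (set0 : set 'rV[R]_n) = 0%E.
Proof.
rewrite /diameter (_ : [set _ | _ in _ & _ in _] = set0); last first.
  by rewrite -subset0 => z [x []].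
by rewrite ereal_sup0; apply/max_idPl; rewrite leNye.
Qed.

Lemma diam_pow_ge0 t X : (0 <= diam_pow t X)%E.
Proof. by rewrite /diam_pow; case: asboolP => // _; exact: poweR_ge0. Qed.

Lemma diam_pow0 t : diam_pow t (set0 : set 'rV[R]_n) = 0%E.
Proof. by rewrite /diam_pow; case: asboolP. Qed.

Lemma euclidean_dist_le_diameter X x y : X x -> X y ->
  ((euclidean_dist x y)%:E <= diameter X)%E.
Proof.
move=> Xx Xy; rewrite /diameter le_max; apply/orP; right.
by apply: ereal_sup_ubound; exists x => //; exists y.
Qed.

Lemma diameter_cube x r : 0 <= r ->
  (diameter (cube x r) <= (2 * n.+1%:R * r)%:E)%E.
Proof.
move=> r0; rewrite /diameter ge_max lee_fin !mulr_ge0 //=.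
apply: ge_ereal_sup => _ [y yx [z zx <-]]; rewrite lee_fin.
apply: (le_trans (euclidean_dist_le_norm _ _)).
have yz : `|y - z| <= 2 * r.
  have := ler_distD x y z; rewrite [`|x - z|]distrC.
  by move: yx zx; rewrite /cube /=; lra.
apply: (le_trans (ler_wpM2l (ler0n R n) yz)).
by rewrite mulrCA mulrA ler_wpM2r // ler_wpM2l // ler_nat.
Qed.

Lemma diam_pow_cube t x r : 0 <= t -> 0 <= r ->
  (diam_pow t (cube x r) <= ((2 * n.+1%:R) `^ t * r `^ t)%:E)%E.
Proof.
move=> t0 r0; rewrite /diam_pow; case: asboolP => _.
  by rewrite lee_fin mulr_ge0 // powR_ge0.
rewrite -powRM // ?mulr_ge0 // -poweR_EFin; apply: gt0_ler_poweR => //.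
- by rewrite in_itv /= diameter_ge0 leey.
- by rewrite in_itv /= lee_fin !mulr_ge0 // leey.
- exact: diameter_cube.
Qed.

Lemma hausdorff_premeasure_ge0 s d E : (0 <= hausdorff_premeasure s d E)%E.
Proof.
apply: le_ereal_inf_tmp => _ [U _ <-]; apply: nneseries_ge0 => i _ _.
exact: diam_pow_ge0.
Qed.

Lemma hausdorff_measure_eq0 s E :
  (forall d e, 0 < d -> 0 < e -> (hausdorff_premeasure s d E <= e%:E)%E) ->
  hausdorff_measure s E = 0%E.
Proof.
move=> H; apply/eqP; rewrite eq_le; apply/andP; split.
  apply: ge_ereal_sup => _ [d /= d0 <-]; apply/lee_addgt0Pr => e e0.
  by rewrite add0e; exact: H.
apply: (le_trans (hausdorff_premeasure_ge0 s 1 E)).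
by apply: ereal_sup_ubound; exists 1 => //=.
Qed.

Lemma hausdorff_premeasure_lt s d E e : hausdorff_measure s E = 0%E ->
  0 < d -> 0 < e -> (hausdorff_premeasure s d E < e%:E)%E.
Proof.
move=> HE d0 e0; apply: (@le_lt_trans _ _ 0%E); last by rewrite lte_fin.
by rewrite -HE; apply: ereal_sup_ubound; exists d.
Qed.

(** The pairs (index of a translate, index in its finite cover) are enumerated
    by one sequence, padded with empty sets. *)
Lemma hausdorff_measure_thin t B (v : nat -> 'rV[R]_n) : 0 <= t -> thin t B ->
  hausdorff_measure t (\bigcup_j [set b + v j | b in B]) = 0%E.
Proof.
move=> t0 thB; apply: hausdorff_measure_eq0 => d e d0 e0.
(* A cube of radius [r] has Euclidean diameter at most [K * r]. *)
pose K : R := 2 * n.+1%:R; have K0 : 0 < K by rewrite mulr_gt0.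
have Kt0 : 0 < K `^ t by rewrite powR_gt0.
pose eta (j : nat) := Num.min (d / K) (e / (2 ^ j.+1)%:R / K `^ t).
have eta0 j : 0 < eta j by rewrite lt_min !divr_gt0 // ltr0n expn_gt0.
have /choice[L LP] j := thB (eta j) (eta0 j).
pose c0 : 'rV[R]_n * R := (0, 0).
pose W (p : nat * nat) : set 'rV[R]_n := if (p.2 < size (L p.1))%N then
  cube ((nth c0 (L p.1) p.2).1 + v p.1) (nth c0 (L p.1) p.2).2 else set0.
pose U k := if pickle_inv k is Some p then W p else set0.
have Lrad j i : (i < size (L j))%N -> 0 < (nth c0 (L j) i).2 <= eta j.
  by move=> ij; have [/(_ (nth c0 (L j) i) (mem_nth _ ij))] := LP j.
apply: ge_ereal_inf; exists (\sum_(0 <= k <oo) diam_pow t (U k))%E.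
  exists U => //; split.
    move=> k; rewrite /U; case: pickle_inv => [[j i]|]; last first.
      by rewrite diameter_set0 lee_fin ltW.
    rewrite /W /=; case: ifPn => [ij|_]; last first.
      by rewrite diameter_set0 lee_fin ltW.
    have /andP[r0 re] := Lrad j i ij.
    apply: (le_trans (diameter_cube _ (ltW r0))); rewrite lee_fin mulrC.
    rewrite -ler_pdivlMr //; apply: (le_trans re); by rewrite ge_min lexx.
  move=> _ [j _ [b Bb <-]]; have [_ _ /(_ b Bb)[c cL bc]] := LP j.
  have ij : (index c (L j) < size (L j))%N by rewrite index_mem.
  exists (pickle (j, index c (L j))) => //; rewrite /U pickleK_inv /W /= ij nth_index //.
  by move: bc; rewrite /cube /= opprD addrACA subrr addr0.
rewrite nneseries_esumT; last by move=> k; exact: diam_pow_ge0.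
have -> : \esum_(k in [set: nat]) diam_pow t (U k) =
    \esum_(k in range (@pickle (nat * nat)%type)) diam_pow t (U k).
  rewrite [RHS]esum_mkcond; apply: eq_esum => k _; case: ifPn => // nk.
  rewrite /U; case Ek: (pickle_inv k) => [p|]; last exact: diam_pow0.
  have := @pickle_invK (nat * nat)%type k; rewrite /oapp Ek => pk.
  by move: nk; rewrite notin_setE => -[]; exists p.
rewrite esum_image; last by move=> p q _ _; exact: (pcan_inj pickleK).
have -> : \esum_(p in [set: nat * nat]) diam_pow t (U (pickle p)) =
    \esum_(j in [set: nat]) \esum_(i in [set: nat]) diam_pow t (W (j, i)).
  rewrite esum_esum; last by move=> *; exact: diam_pow_ge0.
  rewrite (_ : [set: nat] `*`` _ = [set: nat * nat]); last first.
    by apply/seteqP; split.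
  by apply: eq_esum => -[j i] _; rewrite /U pickleK_inv.
rewrite -nneseries_esumT; last first.
  by move=> j; apply: esum_ge0 => i _; exact: diam_pow_ge0.
apply: le_trans (epsilon_trick0 xpredT (ltW e0)).
apply: lee_nneseries => [j _ _|j _].
  by apply: esum_ge0 => i _; exact: diam_pow_ge0.
have -> : \esum_(i in [set: nat]) diam_pow t (W (j, i)) =
    \esum_(i in `I_(size (L j))) diam_pow t (W (j, i)).
  rewrite [RHS]esum_mkcond; apply: eq_esum => i _; case: ifPn => //.
  by rewrite notin_setE /= /W /= => /negP/negbTE ->; exact: diam_pow0.
rewrite esum_fset //; last by move=> i _; exact: diam_pow_ge0.
rewrite -fsbig_ord.
apply: (@le_trans _ _ (\sum_(i < size (L j)) (K `^ t * (nth c0 (L j) i).2 `^ t)%:E)%E).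
  apply: lee_sum => i _; rewrite /W /= ltn_ord.
  by apply: diam_pow_cube => //; have /andP[/ltW] := Lrad j i (ltn_ord i).
rewrite sumEFin lee_fin -mulr_sumr mulrC -ler_pdivlMr //.
have [_ sumL _] := LP j.
move: sumL; rewrite (big_nth c0) big_mkord => sumL.
by apply: (le_trans sumL); rewrite ge_min lexx orbT.
Qed.

End HausdorffNull.

(** * Sums of sets of complementary dimensions *)

Section Volume.
Context {R : realType} {n : nat}.
Implicit Types (x y z : 'rV[R]_n) (r h d : R).

(** Cells of side [h / 2] separate the points of a grid of mesh [h]. *)
Lemma card_grid_cube (W : nat) z c h r : 0 < h <= r ->
  #|[pred g : {ffun 'I_n -> 'I_W.+1} | `[< cube c r (z + grid_point h g) >]]|%:R
    <= (5 * r / h) ^+ n.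
Proof.
move=> /andP[h0 hr]; set S := [pred g | _].
have h20 : 0 < h / 2 by rewrite divr_gt0.
have r20 : 0 <= 2 * r by rewrite mulr_ge0 // ltW // (lt_le_trans h0).
pose f (g : {ffun 'I_n -> 'I_W.+1}) :=
  grid_cell (h / 2) (Num.truncn (2 * r / (h / 2)))
    (z + grid_point h g - c + const_mx r).
have SP g : g \in S -> forall i,
    0 <= (z + grid_point h g - c + const_mx r) ord0 i <= 2 * r.
  rewrite inE => /asboolP/asboolP gc i; have := le_trans (coord_le_norm _ i) gc.
  rewrite !mxE ler_norml; set a := _%:R * h.
  by move=> /andP[? ?]; apply/andP; split; lra.
have finj : {in S &, injective f}.
  move=> g g' gS g'S /(grid_cell_eq h20 (SP g gS) (SP g' g'S)) gg'.
  apply/ffunP => i; apply/val_inj => /=.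
  have := le_trans (coord_le_norm _ i) gg'.
  rewrite !mxE => le_h2.
  have {le_h2}: `|(g i)%:R - (g' i)%:R| * h <= h / 2.
    rewrite -[X in _ * X]gtr0_norm // -normrM; apply: le_trans le_h2.
    by rewrite le_eqVlt; apply/orP; left; apply/eqP; congr (`|_|); ring.
  rewrite -ler_pdivlMr // mulrAC divff ?gt_eqF // mul1r => le_half.
  apply/eqP; rewrite eqn_leq; apply/andP; split; rewrite leqNgt; apply/negP;
    rewrite -(ler_nat R) -natr1; move: le_half; rewrite ler_norml; lra.
rewrite -(card_in_image finj).
apply: (@le_trans _ _ ((2 * r / (h / 2) + 1) ^+ n)).
  by apply: le_trans (card_grid h20 r20); rewrite ler_nat max_card.
have rh : 1 <= r / h by rewrite ler_pdivlMr // mul1r.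
have -> : 2 * r / (h / 2) = 4 * (r / h) by field; rewrite gt_eqF.
by rewrite -[5 * r / h]mulrA lerXn2r ?nnegrE; lra.
Qed.

(** On a grid finer than every member of the cover, numbers of grid points are
    proportional to volumes up to constants, and numbers of points add up. *)
Lemma cube_cover_volume z d (L : seq ('rV[R]_n * R)) : 0 < d ->
  (forall c, c \in L -> 0 < c.2) ->
  (forall y, cube z d y -> exists2 c, c \in L & cube c.1 c.2 y) ->
  d ^+ n <= 5 ^+ n * \sum_(c <- L) c.2 ^+ n.
Proof.
move=> d0 L0 cov.
have [h h0 hL] : exists2 h, 0 < h & forall c, c \in L -> h <= c.2.
  elim: L L0 {cov} => [|c L IH] L0; first by exists 1.
  have [|h h0 hL] := IH; first by move=> b bL; apply: L0; rewrite inE bL orbT.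
  have c0 := L0 c (mem_head _ _).
  exists (Num.min h c.2); first by rewrite lt_min h0.
  move=> b; rewrite inE ge_min => /predU1P[->|/hL->//]; by rewrite lexx orbT.
pose W := Num.truncn (d / h).
pose S (c : 'rV[R]_n * R) := [pred g : {ffun 'I_n -> 'I_W.+1} |
  `[< cube c.1 c.2 (z + grid_point h g) >]].
have dh0 : 0 <= d / h by rewrite divr_ge0 // ltW.
have cardW : (d / h) ^+ n <= #|{ffun 'I_n -> 'I_W.+1}|%:R.
  rewrite card_ffun !card_ord natrX lerXn2r ?nnegrE //.
  exact/ltW/truncnS_gt.
have covS : (#|{ffun 'I_n -> 'I_W.+1}| <= \sum_(c <- L) #|S c|)%N.
  have -> : #|{ffun 'I_n -> 'I_W.+1}| = #|[pred g | has (fun c => S c g) L]|.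
    apply: eq_card => g; rewrite [LHS]inE [RHS]inE; apply/esym/hasP.
    have /cov[c cL gc] : cube z d (z + grid_point h g).
      rewrite /cube /= addrC addKr; apply: norm_le_coord => [|i]; first exact: ltW.
      have /andP[? ?] := grid_point_itv g i h0 (ltW d0).
      by rewrite ger0_norm.
    by exists c => //; apply/asboolP.
  elim: L {L0 cov hL} => [|c L IH]; first by rewrite big_nil eq_card0.
  rewrite big_cons (leq_trans _ (leq_add (leqnn _) IH)) //.
  by rewrite -cardUI (leq_trans _ (leq_addr _ _)) // subset_leq_card.
have : (d / h) ^+ n <= \sum_(c <- L) (5 * c.2 / h) ^+ n.
  apply: (le_trans cardW); move: covS; rewrite -(ler_nat R) => /le_trans; apply.
  rewrite natr_sum big_seq [leRHS]big_seq; apply: ler_sum => c cL.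
  by apply: card_grid_cube; rewrite h0 hL.
under eq_bigr => c _ do rewrite !exprMn.
by rewrite -!mulr_suml -mulr_sumr exprMn ler_pM2r // exprVn invr_gt0 exprn_gt0.
Qed.

End Volume.

Section SumNull.
Context {R : realType} {n : nat}.
Implicit Types (x y z : 'rV[R]_n) (A B F U : set 'rV[R]_n) (r h d s t : R).

(** A maximal separated list is a net; the bound [m] makes one exist. *)
Lemma maximal_spaced F r (m : nat) : 0 < r ->
  (forall l, spaced r l -> (forall x, x \in l -> F x) -> (size l <= m)%N) ->
  exists l, [/\ spaced r l, forall x, x \in l -> F x &
    forall y, F y -> exists2 x, x \in l & cube x r y].
Proof.
move=> r0 bound.
pose P k := `[< exists l, [/\ spaced r l, forall x, x \in l -> F x & size l = k] >].
have exP : exists k, P k by exists 0%N; apply/asboolP; exists [::].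
have ubP k : P k -> (k <= m)%N by move=> /asboolP[l [sl lF <-]]; exact: bound.
have [k /asboolP[l [sl lF lk]] kmax] := ex_maxnP exP ubP.
exists l; split => // y Fy; apply: contrapT => far.
have /kmax : P k.+1; last by rewrite ltnn.
apply/asboolP; exists (y :: l); split => /=; last by rewrite lk.
  rewrite sl andbT; apply/allP => x xl; rewrite ltNge; apply/negP => yx.
  by apply: far; exists x.
by move=> x; rewrite inE => /predU1P[->//|]; exact: lF.
Qed.

(** The scale of the net of [F] is the diameter of [U] or, when [U] is a point,
    any number whose [t]-th power exceeds [0 `^ t] by at most [e]. *)
Lemma box_bounded_sum_cover F s t d C :
  0 <= t -> s + t <= n%:R -> 0 < d <= 1 -> 0 < C ->
  (forall r l, 0 < r <= d -> spaced r l -> (forall x, x \in l -> F x) ->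
    (size l)%:R <= C * r `^ (- s)) ->
  forall U e, (diameter U <= d%:E)%E -> 0 < e ->
  exists (r : R) (L : seq 'rV[R]_n), [/\ 0 < r,
    (((size L)%:R * r ^+ n / C)%:E <= diam_pow t U + e%:E)%E &
    forall a b, F a -> U b -> exists2 c, c \in L & `|a + b - c| <= 2 * r].
Proof.
move=> t0 stn /andP[d0 d1] C0 HC U e Ud e0.
have [U0|/set0P[b0 Ub0]] := eqVneq U set0.
  exists 1, [::]; split => //; last by move=> a b _; rewrite U0.
  by rewrite mul0r mul0r adde_ge0 ?diam_pow_ge0 ?lee_fin ?ltW.
have [r [r0 rd Ur rt]] : exists r, [/\ 0 < r, r <= d, (diameter U <= r%:E)%E &
    ((r `^ t)%:E <= diam_pow t U + e%:E)%E].
  have -> : diam_pow t U = (diameter U `^ t)%E.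
    by rewrite /diam_pow; case: asboolP => // U0; move: Ub0; rewrite U0.
  move: Ud; have := diameter_ge0 U; case: (diameter U) => [D| |] //.
  rewrite !lee_fin => D0 Dd.
  have [D_gt0|] := ltP 0 D.
    by exists D; split => //; rewrite poweR_EFin -EFinD lee_fin lerDl ltW.
  move=> D_le0; have -> : D = 0 by apply/eqP; rewrite eq_le D_le0.
  have [t00|t_gt0] := leP t 0.
    have -> : t = 0 by apply/eqP; rewrite eq_le t00.
    exists d; split => //; first by rewrite lee_fin ltW.
    by rewrite poweRe0 powRr0 -EFinD lee_fin lerDl ltW.
  have [g g0 Hg] := powR_small t_gt0 e0.
  exists (Num.min d g); split.
  - by rewrite lt_min d0.
  - by rewrite ge_min lexx.
  - by rewrite lee_fin ltW // lt_min d0.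
  - rewrite poweR_EFin -EFinD lee_fin -[leLHS]add0r lerD ?powR_ge0 //.
    by apply: Hg; rewrite le_min (ltW d0) (ltW g0) ge_min lexx orbT.
have [l [sl lF net]] : exists l, [/\ spaced r l, forall x, x \in l -> F x &
    forall y, F y -> exists2 x, x \in l & cube x r y].
  apply: (@maximal_spaced _ _ (Num.truncn (C * r `^ (- s)))) => // l sl lF.
  rewrite truncn_ge_nat ?mulr_ge0 ?powR_ge0 ?(ltW C0) //.
  by apply: HC => //; rewrite r0.
exists r, [seq x + b0 | x <- l]; split => //.
  rewrite size_map; apply: le_trans rt; rewrite lee_fin ler_pdivrMr // mulrC.
  apply: (@le_trans _ _ (r ^+ n * (C * r `^ (- s)))).
    by rewrite ler_wpM2l ?exprn_ge0 ?(ltW r0) // HC // r0.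
  rewrite mulrCA [leRHS]mulrC ler_pM2l // -powR_mulrn ?(ltW r0) //.
  rewrite -powRD ?(gt_eqF r0) ?implybT // ger_powR ?r0 ?(le_trans rd) //.
  by lra.
move=> a b /net[x xl ax] Ub; exists (x + b0); first exact: map_f.
have bb0 : `|b - b0| <= r.
  apply: (le_trans (norm_le_euclidean_dist _ _)).
  by rewrite -lee_fin (le_trans (euclidean_dist_le_diameter Ub Ub0)).
have := ler_normD (a - x) (b - b0); rewrite addrACA -opprD.
by move: ax; rewrite /cube /=; lra.
Qed.

(** The sum has volume zero. Cover [B] with small [t]-dimensional sum; for each
    member of the cover, of diameter [r], a net of [A] with about [r `^ (- s)]
    points gives that many cubes of volume about [r ^+ n], and [n - s >= t]. *)
Lemma no_cube_in_sum A B s t z d : 0 <= t -> s + t <= n%:R ->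
  sigma_box_bounded s A -> hausdorff_measure t B = 0%E -> 0 < d ->
  ~ (cube z d `<=` minkowski_sum A B).
Proof.
move=> t0 stn [F [AF bF]] HB d0 sub.
have /choice[Cd CdP] i : exists Cd : R * R, [/\ 0 < Cd.2 <= 1, 0 < Cd.1 &
    forall r l, 0 < r <= Cd.2 -> spaced r l -> (forall x, x \in l -> F i x) ->
      (size l)%:R <= Cd.1 * r `^ (- s)].
  have [C [e [e0 HC]]] := bF i; exists (`|C| + 1, Num.min e 1); split => /=.
  - by rewrite lt_min e0 ltr01 ge_min lexx orbT.
  - by rewrite ltr_wpDl.
  - move=> r l /andP[r0]; rewrite le_min => /andP[re _] sl lF.
    apply: (le_trans (HC r l _ sl lF)); first by rewrite r0.
    by rewrite ler_wpM2r ?powR_ge0 // (le_trans (ler_norm C)) // lerDl.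
(* The factor 15 is 5, from the comparison of volumes, times 3, from the radii of
   the open cover. *)
pose V := d ^+ n / (4 * 15 ^+ n).
have V0 : 0 < V by rewrite divr_gt0 ?mulr_gt0 ?exprn_gt0.
(* Each [F i] has its own constant in the bound on its nets, divided out here. *)
pose eps i := V / (2 ^ i.+1)%:R / (Cd i).1.
have eps0 i : 0 < eps i.
  have [_ C0 _] := CdP i; apply: divr_gt0 => //; apply: divr_gt0 => //.
have /choice[U UP] i : exists U : nat -> set 'rV[R]_n,
    [/\ forall j, (diameter (U j) <= (Cd i).2%:E)%E, B `<=` \bigcup_j U j &
        (\sum_(0 <= j <oo) diam_pow t (U j) < (eps i)%:E)%E].
  have [/andP[e0 _] _ _] := CdP i.
  have /ereal_inf_lt[_ [U [/= Ud BU] <-] Ue] := hausdorff_premeasure_lt HB e0 (eps0 i).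
  by exists U.
have /choice[rL rLP] (ij : nat * nat) : exists rL : R * seq 'rV[R]_n, [/\ 0 < rL.1,
    (((size rL.2)%:R * rL.1 ^+ n / (Cd ij.1).1)%:E <=
      diam_pow t (U ij.1 ij.2) + (eps ij.1 / (2 ^ ij.2.+1)%:R)%:E)%E &
    forall a b, F ij.1 a -> U ij.1 ij.2 b ->
      exists2 c, c \in rL.2 & `|a + b - c| <= 2 * rL.1].
  have [Cd2 Cd1 HC] := CdP ij.1; have [Ud _ _] := UP ij.1.
  have [|r [L [r0 sL cL]]] := box_bounded_sum_cover t0 stn Cd2 Cd1 HC (Ud ij.2)
      (e := eps ij.1 / (2 ^ ij.2.+1)%:R).
    by rewrite divr_gt0 // ltr0n expn_gt0.
  by exists (r, L).
pose cov K : seq ('rV[R]_n * R) := flatten [seq flatten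
  [seq [seq (c, 3 * (rL (i, j)).1) | c <- (rL (i, j)).2]
    | j <- index_iota 0 K] | i <- index_iota 0 K].
have covP K c : c \in cov K <-> exists i j x, [/\ (i < K)%N, (j < K)%N,
    x \in (rL (i, j)).2 & c = (x, 3 * (rL (i, j)).1)].
  split.
    move=> /flatten_mapP[i]; rewrite mem_index_iota /= => iK.
    move=> /flatten_mapP[j]; rewrite mem_index_iota /= => jK /mapP[x xL ->].
    by exists i, j, x.
  move=> [i [j [x [iK jK xL ->]]]].
  apply/flatten_mapP; exists i; first by rewrite mem_index_iota.
  apply/flatten_mapP; exists j; first by rewrite mem_index_iota.
  by apply/mapP; exists x.
pose O K : set 'rV[R]_n := \bigcup_(c in [set` cov K]) ball c.1 c.2.
have [|||K KO] := @compact_increasing R n (cube z d) O (@compact_cube R n z d).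
- by move=> K; apply: bigcup_open => c _; exact: ball_open.
- move=> K y [c /= /covP[i [j [x [iK jK xL cE]]]] yc]; exists c => //=.
  by apply/covP; exists i, j, x; split => //; exact: ltnW.
- move=> y /sub[a Aa [b Bb <-]].
  have [i _ Fa] := AF a Aa; have [_ BU _] := UP i.
  have [j _ Ub] := BU b Bb; have [r0 _ /(_ a b Fa Ub)[x xL abx]] := rLP (i, j).
  exists (maxn i j).+1 => //; exists (x, 3 * (rL (i, j)).1) => /=.
    apply/covP; exists i, j, x; split => //.
      by rewrite ltnS leq_maxl.
    by rewrite ltnS leq_maxr.
  by rewrite -ball_normE /= distrC (le_lt_trans abx) // ltr_pM2r // ltr_nat.
have : d ^+ n <= 5 ^+ n * \sum_(c <- cov K) c.2 ^+ n.
  apply: (@cube_cover_volume R n z) => // [c /covP[i [j [x [_ _ _ ->]]]]|y /KO[c cK yc]].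
    by have [r0 _ _] := rLP (i, j); rewrite mulr_gt0.
  exists c => //; move: yc; rewrite -ball_normE /cube /= distrC; exact: ltW.
apply/negP; rewrite -ltNge.
have sum_j i : \sum_(j < K) (size (rL (i, val j)).2)%:R * (rL (i, val j)).1 ^+ n <=
    2 * V / (2 ^ i.+1)%:R.
  have [_ C0 _] := CdP i; have [_ _ Ue] := UP i.
  have : ((\sum_(j < K) (size (rL (i, val j)).2)%:R * (rL (i, val j)).1 ^+ n / (Cd i).1)%:E
      <= (2 * eps i)%:E)%E.
    rewrite -sumEFin.
    apply: (@le_trans _ _ (\sum_(j < K) (diam_pow t (U i j) +
        (eps i / (2 ^ j.+1)%:R)%:E))%E).
      by apply: lee_sum => j _; have [_] := rLP (i, val j).
    rewrite big_split /= mulr2n mulrDl mul1r EFinD leeD //.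
      apply: le_trans (ltW Ue); rewrite -(big_mkord xpredT (fun j => diam_pow t (U i j))).
      by apply: nneseries_lim_ge => j _ _; exact: diam_pow_ge0.
    rewrite sumEFin lee_fin -mulr_sumr -[leRHS]mulr1 ler_wpM2l ?(ltW (eps0 i)) //.
    exact: half_powers_sum_le.
  rewrite lee_fin -mulr_suml ler_pdivrMr // => /le_trans; apply.
  by rewrite /eps -[leLHS]mulrA divfK ?gt_eqF // mulrA.
have -> : \sum_(c <- cov K) c.2 ^+ n = 3 ^+ n *
    \sum_(i < K) \sum_(j < K) (size (rL (val i, val j)).2)%:R * (rL (val i, val j)).1 ^+ n.
  rewrite /cov big_flatten /= big_map big_mkord mulr_sumr.
  apply: eq_bigr => i _; rewrite big_flatten /= big_map big_mkord mulr_sumr.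
  apply: eq_bigr => j _; rewrite big_map /= big_const_seq count_predT iter_addr_0.
  by rewrite exprMn -[LHS]mulr_natl mulrCA.
rewrite mulrA -exprMn.
have : \sum_(i < K) \sum_(j < K) (size (rL (val i, val j)).2)%:R *
    (rL (val i, val j)).1 ^+ n <= 2 * V.
  apply: (@le_trans _ _ (\sum_(i < K) 2 * V / (2 ^ i.+1)%:R)).
    by apply: ler_sum => i _; exact: sum_j.
  have V20 : 0 <= 2 * V by apply: mulr_ge0 => //; exact: ltW.
  rewrite -mulr_sumr -[leRHS]mulr1 ler_wpM2l //.
  exact: half_powers_sum_le.
have p15 : 0 < (5 * 3 : R) ^+ n by rewrite exprn_gt0.
move=> /(ler_wpM2l (ltW p15)) /le_lt_trans; apply.
rewrite /V (_ : 15 = 5 * 3 :> R); last by ring.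
rewrite (_ : (5 * 3) ^+ n * _ = d ^+ n / 2); last first.
  by field; rewrite expf_neq0 //.
by rewrite ltr_pdivrMr // ltr_pMr ?exprn_gt0 // ltr1n.
Qed.

End SumNull.

(** * Packing dimension as a codimension *)

Section Codimension.
Context {R : realType} {n : nat}.
Implicit Types (A B : set 'rV[R]_n) (s t : R).

Lemma packing_dim_le A s : 0 <= s -> packing_measure s A = 0%E ->
  (packing_dim A <= s%:E)%E.
Proof. by move=> s0 PA; apply: ereal_inf_lbound; exists s. Qed.

Lemma packing_dim_itv A : (0 <= packing_dim A <= n%:R%:E)%E.
Proof.
apply/andP; split.
  by apply: le_ereal_inf_tmp => _ [s [s0 _] <-]; rewrite lee_fin.
apply/lee_addgt0Pr => e e0; apply: packing_dim_le.
  by rewrite addr_ge0 // ltW.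
apply: (@sigma_box_bounded_packing_measure _ _ n%:R); first by rewrite ltrDl.
  by rewrite addr_ge0 // ltW.
exact: sigma_box_bounded_sub (subsetT _) sigma_box_boundedT.
Qed.

Lemma not_sigma_box_bounded A s : A !=set0 -> (s%:E < packing_dim A)%E ->
  ~ sigma_box_bounded s A.
Proof.
move=> /set0P A0 sA bA; have [s0|s0] := ltP s 0.
  by move: A0; rewrite (sigma_box_bounded_neg s0 bA) eqxx.
have /andP[D0 Dn] := packing_dim_itv A.
move: sA D0 Dn; case E : (packing_dim A) => [D| |] //; rewrite lte_fin => sD _ _.
have : (packing_dim A <= ((s + D) / 2)%:E)%E.
  have sm : 0 <= (s + D) / 2 by rewrite divr_ge0 // addr_ge0 // ltW // (le_lt_trans s0).
  apply: packing_dim_le => //; apply: (sigma_box_bounded_packing_measure _ sm bA).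
  lra.
by rewrite E lee_fin; lra.
Qed.

(** Both infima are computed in this way: the first property of the class [S]
    bounds the dimensions of its members from below, the second supplies members
    of nearly minimal dimension. *)
Lemma packing_dim_codimension A (S : set (set 'rV[R]_n)) :
  (forall B, S B -> exists z d, 0 < d /\ cube z d `<=` minkowski_sum A B) ->
  (forall t, 0 < t -> (n%:R%:E - packing_dim A < t%:E)%E ->
    exists2 B, S B & hausdorff_measure t B = 0%E) ->
  packing_dim A = (n%:R%:E - ereal_inf [set hausdorff_dim B | B in S])%E.
Proof.
move=> Scube Sdim; have /andP[] := packing_dim_itv A.
case E : (packing_dim A) => [D| |] //; rewrite !lee_fin => D0 Dn.
suff -> : ereal_inf [set hausdorff_dim B | B in S] = (n%:R - D)%:E.
  by rewrite -EFinB opprB addrC subrK.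
apply/eqP; rewrite eq_le; apply/andP; split.
  apply/lee_addgt0Pr => e e0; have t0 : 0 < n%:R - D + e by lra.
  have [|B SB HB] := Sdim _ t0; first by rewrite E -EFinB lte_fin ltrDl.
  apply: ge_ereal_inf; exists (hausdorff_dim B); first by exists B.
  rewrite -EFinD; apply: ereal_inf_lbound; exists (n%:R - D + e) => //.
  by split => //; exact: ltW.
apply: le_ereal_inf_tmp => _ [B /Scube[z [d [d0 sub]]] <-].
apply: le_ereal_inf_tmp => _ [t [t0 HB] <-]; rewrite lee_fin leNgt.
apply/negP => tD; have : (packing_dim A < (n%:R - t)%:E)%E.
  by rewrite E lte_fin; lra.
move=> /ereal_inf_lt[_ [s [s0 PA] <-]]; rewrite lte_fin => st.
apply: (@no_cube_in_sum _ _ A B s t z d) => //; first by lra.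
exact: packing_measure_sigma_box_bounded.
Qed.

Lemma thin_hausdorff_measure t B : 0 <= t -> thin t B -> hausdorff_measure t B = 0%E.
Proof.
move=> t0 thB; have <- : \bigcup_(j : nat) [set b + 0 | b in B] = B; last first.
  exact: (hausdorff_measure_thin (fun=> 0)).
apply/seteqP; split => [_ [_ _ [b Bb <-]]|b Bb]; first by rewrite addr0.
by exists 0%N => //; exists b => //; rewrite addr0.
Qed.

End Codimension.

Theorem theorem1p8 (R : realType) (n : nat) (hn : (1 <= n)%N)
    (A : set 'rV[R]_n) (hA0 : A !=set0) (hA : borel_set A) :
  packing_dim A =
    (n%:R%:E - ereal_inf [set hausdorff_dim B | B in
       [set B : set 'rV[R]_n |
         compact B /\ interior (minkowski_sum A B) !=set0]])%E /\
  packing_dim A =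
    (n%:R%:E - ereal_inf [set hausdorff_dim B | B in
       [set B : set 'rV[R]_n |
         borel_set B /\ minkowski_sum A B = [set: 'rV[R]_n]]])%E.
Proof.
have summand t : 0 < t -> (n%:R%:E - packing_dim A < t%:E)%E ->
    exists (B : set 'rV[R]_n) z d, [/\ compact B, thin t B, 0 < d &
      cube z d `<=` minkowski_sum A B].
  move=> t0 nt; have /andP[D0 Dn] := packing_dim_itv A.
  move: nt D0 Dn; case E : (packing_dim A) => [D| |] //.
  rewrite -EFinB lte_fin => nt _ _.
  apply: (@thin_summand _ _ A ((n%:R - t + D) / 2)) => //; first exact: borel_suslin.
    by lra.
  by apply: not_sigma_box_bounded => //; rewrite E lte_fin; lra.
split; apply: packing_dim_codimension.
- move=> B [_ [z /nbhs_ballP[e /= e0 ze]]]; exists z, (e / 2); split.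
    by rewrite divr_gt0.
  move=> y zy; apply: ze; rewrite -ball_normE /= distrC (le_lt_trans zy) //.
  by rewrite ltr_pdivrMr // ltr_pMr // ltr1n.
- move=> t t0 /(summand t t0)[B [z [d [cB thB d0 sub]]]]; exists B.
    split => //; exists z; apply/nbhs_ballP; exists d => //= y.
    rewrite -ball_normE /= => /ltW zy; apply: sub.
    by rewrite /cube /= distrC.
  by apply: thin_hausdorff_measure => //; exact: ltW.
- by move=> B [_ AB]; exists 0, 1; split => //; rewrite AB.
- move=> t t0 /(summand t t0)[B [z [d [cB thB d0 sub]]]].
  pose v (j : nat) := if unpickle j is Some g then lattice_point d g else 0 : 'rV[R]_n.
  exists (\bigcup_j [set b + v j | b in B]); last first.
    by apply: hausdorff_measure_thin => //; exact: ltW.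
  split.
    apply: sigma_algebra_bigcup => j; apply: borel_closed; apply: closed_translate.
    apply: compact_closed => //; exact: norm_hausdorff.
  apply/seteqP; split => // x _; have [g xg] := lattice_near (x - z) d0.
  have /sub[a Aa [b Bb ab]] : cube z d (x - lattice_point d g).
    by move: xg; rewrite /cube /= addrAC.
  exists a => //; exists (b + v (pickle g)); first by exists (pickle g) => //; exists b.
  by rewrite /v pickleK addrA ab subrK.
Qed.
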